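(* Let $A:\mathbb{R}^n\rightarrow\mathbb{R}^n$ be a generalized even oscillatory linear operator. Then the algebraic multiplicity $m(\lambda)$ of any eigenvalue $\lambda$ of $A$ is not greater than $2$. Let $\lambda_1,\ldots,\lambda_n$ be the (complex) eigenvalues of $A$, repeated according to algebraic multiplicity and numbered in order of non-increasing modulus. Then $$\rho(A)=|\lambda_1|\geq|\lambda_2|>|\lambda_3|\geq|\lambda_4|>\ldots,$$ that is, $|\lambda_i|>|\lambda_{i+1}|$ for every even $i$ with $i+1\le n$. Moreover, for every pair $\lambda_i,\lambda_{i+1}$ with $i=1,3,5,\ldots$ and $i+1\le n$, one has $\arg(\lambda_{i+1})=-\arg(\lambda_i)$ (modulo $2\pi$). If $n$ is odd, then $\lambda_n$ is real.
   Context: $\rho(A)$ denotes the spectral radius of $A$. A set $K\subset\mathbb{R}^N$ is a proper cone if it is a convex cone (for $x,y\in K$, $\alpha\ge 0$ one has $x+y,\alpha x\in K$), pointed ($K\cap(-K)=\{0\}$), closed and solid ($\mathrm{int}(K)\neq\emptyset$). A linear operator $B:\mathbb{R}^N\to\mathbb{R}^N$ is primitive with respect to a proper cone $K$ ($K$-primitive) if $BK\subseteq K$ and the only nonempty subset $S$ of the boundary $\partial(K)$ which is left invariant by $B$ (i.e. $BS\subseteq S$) is $\{0\}$. When $N=1$, the zero operator is not regarded as primitive (so for $N=1$ primitive means multiplication by a positive number). The $j$th exterior power $\wedge^jA$ of a linear operator $A$ on $\mathbb{R}^n$ is the linear operator on $\wedge^j\mathbb{R}^n$ defined by $(\wedge^jA)(x_1\wedge\ldots\wedge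 x_j)=Ax_1\wedge\ldots\wedge Ax_j$. The space $\wedge^j\mathbb{R}^n$ is identified with $\mathbb{R}^{C_n^j}$, $C_n^j=\frac{n!}{j!(n-j)!}$, via the basis $e_{i_1}\wedge\ldots\wedge e_{i_j}$, $1\le i_1<\ldots<i_j\le n$, where $e_1,\ldots,e_n$ is a basis of $\mathbb{R}^n$. In particular $\wedge^1A=A$, and $\wedge^nA$ is multiplication by $\det A$ on a one-dimensional space. A linear operator $A:\mathbb{R}^n\to\mathbb{R}^n$ is called generalized even oscillatory if for every even $j$ with $1\le j\le n$ its $j$th exterior power $\wedge^jA$ is primitive with respect to a proper cone $K_j\subset\mathbb{R}^{C_n^j}$. *)

(* Defs.v *)
From HB Require Import structures.
From mathcomp Require Import all_boot all_order all_algebra all_fingroup.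
From mathcomp Require Import all_classical all_reals all_analysis.
From mathcomp Require Import complex.

Set Implicit Arguments.
Unset Strict Implicit.
Unset Printing Implicit Defensive.

Import Order.TTheory GRing.Theory Num.Theory.
Import numFieldNormedType.Exports.

Local Open Scope classical_set_scope.
Local Open Scope ring_scope.

(** Linear operators on R^N are N x N matrices acting on column vectors by
    x |-> B *m x. *)

Section Cones.
Variables (R : realType) (N : nat).
Implicit Types (K S : set 'cV[R]_N) (B : 'M[R]_N).

Definition proper_cone K : Prop :=
  [/\ forall x y, K x -> K y -> K (x + y),
      forall (a : R) x, 0 <= a -> K x -> K (a *: x),
      K `&` [set - x | x in K] = [set 0],
      closed K
    & interior K !=set0].

Definition boundary K : set 'cV[R]_N := closure K `\` interior K.

Definition invariant_set B S : Prop := [set B *m x | x in S] `<=` S.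

(* The last clause only matters for N = 1: there the boundary of a proper cone
   is {0}, so that the zero operator would satisfy the other two. *)
Definition cone_primitive K B : Prop :=
  [/\ invariant_set B K,
      forall S, [/\ S !=set0, S `<=` boundary K & invariant_set B S] <->
                S = [set 0]
    & N = 1%N -> B != 0].

End Cones.

Section ExteriorPower.
Variables (R : realType) (n j : nat).

Definition incr_tuples : {set j.-tuple 'I_n} :=
  [set t : j.-tuple 'I_n | sorted ltn [seq val i | i <- t]]%SET.

Lemma card_incr_tuples : 'C(n, j) = #|incr_tuples|.
Proof. by rewrite -card_ltn_sorted_tuples. Qed.

(* The k-th sequence i_1 < ... < i_j, for a fixed enumeration of all of them. *)
Definition incr (k : 'I_('C(n, j))) : j.-tuple 'I_n :=
  enum_val (cast_ord card_incr_tuples k).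

(* The coordinates of x_1 /\ ... /\ x_j in the basis e_{i_1} /\ ... /\ e_{i_j}
   (i_1 < ... < i_j) are the j x j minors of the matrix [x_1 ... x_j]. *)
Definition wedge (x : 'I_j -> 'cV[R]_n) : 'cV[R]_('C(n, j)) :=
  \col_k \det (\matrix_(p < j, q < j) x q (tnth (incr k) p) 0).

Definition basis_vec (i : 'I_n) : 'cV[R]_n := delta_mx i 0.

(* Column l is the image A e_{i_1} /\ ... /\ A e_{i_j} of the l-th basis vector;
   ext_power_wedge below gives the image of an arbitrary x_1 /\ ... /\ x_j. *)
Definition ext_power (A : 'M[R]_n) : 'M[R]_('C(n, j)) :=
  \matrix_(k, l) wedge (fun q => A *m basis_vec (tnth (incr l) q)) k 0.

End ExteriorPower.

Section ExteriorPowerTheory.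
Variables (R : realType) (n j : nat).

Lemma incr_sorted (k : 'I_('C(n, j))) : sorted ltn [seq val i | i <- incr k].
Proof. by have := enum_valP (cast_ord (card_incr_tuples n j) k); rewrite inE. Qed.

Lemma incr_inj : injective (@incr n j).
Proof. by move=> k l /enum_val_inj /cast_ord_inj. Qed.

Lemma incr_uniq (k : 'I_('C(n, j))) : uniq (incr k).
Proof.
have := sorted_uniq ltn_trans ltnn (incr_sorted k).
by rewrite map_inj_uniq //; apply: val_inj.
Qed.

Lemma incr_mem_inj (k l : 'I_('C(n, j))) : incr k =i incr l -> k = l.
Proof.
move=> e; apply/incr_inj/val_inj/(inj_map val_inj).
apply: (irr_sorted_eq ltn_trans ltnn); try exact: incr_sorted.
by move=> m; apply/mapP/mapP => -[i im ->]; exists i => //; rewrite ?e // -e.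
Qed.

Definition incr_perm (ls : 'I_('C(n, j)) * 'S_j) : {ffun 'I_j -> 'I_n} :=
  [ffun p => tnth (incr ls.1) (ls.2 p)].

Lemma incr_perm_inj : injective incr_perm.
Proof.
have memE (k : 'I_('C(n, j))) (s : 'S_j) :
    incr k =i codom (incr_perm (k, s)).
  move=> i; apply/tnthP/codomP => [[p ->]|[p ->]].
    by exists ((s^-1)%g p); rewrite ffunE /= permKV.
  by exists (s p); rewrite ffunE.
move=> [k s] [l t] e.
have kl : k = l by apply: incr_mem_inj => i; rewrite (memE _ s) e -memE.
rewrite -{l}kl in e *; congr (_, _); apply/permP => p.
have /(congr1 (fun f : {ffun 'I_j -> 'I_n} => f p)) := e.
rewrite !ffunE /=; apply: tuple_uniqP; exact: incr_uniq.
Qed.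

Lemma incr_perm_imset :
  (incr_perm @: [set: 'I_('C(n, j)) * 'S_j] =
   [set f : {ffun 'I_j -> 'I_n} | injectiveb f])%SET.
Proof.
apply/eqP; rewrite eqEcard; apply/andP; split.
  apply/fintype.subsetP => _ /imsetP[[k s] _ ->]; rewrite inE.
  apply/injectiveP => p q; rewrite !ffunE /= => /tuple_uniqP.
  by move=> /(_ (incr_uniq k)) /perm_inj.
rewrite card_imset; last exact: incr_perm_inj.
rewrite cardsT card_prod card_ord card_Sn bin_ffact.
have := card_inj_ffuns 'I_j 'I_n; rewrite !card_ord => <-.
by rewrite cardsE.
Qed.

Lemma cauchy_binet (M : 'M[R]_(j, n)) (X : 'M[R]_(n, j)) :
  \det (M *m X) =
  \sum_(l < 'C(n, j)) \det (\matrix_(p < j, q < j) M p (tnth (incr l) q)) *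
                      \det (\matrix_(p < j, q < j) X (tnth (incr l) p) q).
Proof.
pose F (f : {ffun 'I_j -> 'I_n}) : R :=
  (\prod_p M p (f p)) * \det (\matrix_(p < j, q < j) X (f p) q).
have -> : \det (M *m X) = \sum_f F f.
  rewrite /determinant.
  under eq_bigr => s _.
    under eq_bigr => p _ do rewrite mxE.
    rewrite bigA_distr_bigA /= mulr_sumr.
    over.
  rewrite exchange_big /=; apply: eq_bigr => f _.
  rewrite /F /determinant mulr_sumr; apply: eq_bigr => s _.
  rewrite big_split /= mulrCA; congr (_ * (_ * _)).
  by apply: eq_bigr => p _; rewrite mxE.
rewrite (bigID (fun f : {ffun 'I_j -> 'I_n} => injectiveb f)) /=.
rewrite [X in _ + X]big1 ?addr0; last first.
  move=> f /injectivePn [p [q pq fpq]]; rewrite /F.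
  rewrite (determinant_alternate pq) ?mulr0 // => r.
  by rewrite !mxE fpq.
transitivity (\sum_(f in [set incr_perm ls | ls in [set: 'I_('C(n, j)) * 'S_j]]%SET) F f).
  by apply: eq_bigl => f; rewrite incr_perm_imset inE.
rewrite big_imset /=; last by move=> ? ? _ _; apply: incr_perm_inj.
rewrite (eq_bigl xpredT) => [|ls]; last by rewrite inE.
rewrite (eq_bigr (fun ls => F (incr_perm (ls.1, ls.2)))) => [|[] //].
rewrite -(pair_bigA _ (fun l s => F (incr_perm (l, s)))) /=.
apply: eq_bigr => l _; rewrite [in RHS]/determinant mulr_suml.
apply: eq_bigr => s _; rewrite /F.
set Y := \matrix_(p, q) X (tnth (incr l) p) q.
have -> : \matrix_(p, q) X (incr_perm (l, s) p) q = row_perm s Y.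
  by apply/matrixP => p q; rewrite !mxE ffunE.
rewrite row_permE det_mulmx det_perm mulrCA mulrA; congr (_ * _ * _).
by apply: eq_bigr => p _; rewrite !mxE ffunE.
Qed.

Lemma ext_power_wedge (A : 'M[R]_n) (x : 'I_j -> 'cV[R]_n) :
  ext_power j A *m wedge x = wedge (fun q => A *m x q).
Proof.
apply/matrixP => k z; rewrite {z}ord1 !mxE.
pose M : 'M[R]_(j, n) := rowsub (tnth (incr k)) A.
pose X : 'M[R]_(n, j) := \matrix_(i, q) x q i 0.
have -> : \matrix_(p < j, q < j) (A *m x q) (tnth (incr k) p) 0 = M *m X.
  by apply/matrixP => p q; rewrite !mxE; apply: eq_bigr => i _; rewrite !mxE.
rewrite cauchy_binet; apply: eq_bigr => l _; rewrite !mxE;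
  congr (_ * _); congr (\det _).
  by apply/matrixP => p q; rewrite mxE [in RHS]mxE /basis_vec -colE !mxE.
by apply/matrixP => p q; rewrite !mxE.
Qed.

Lemma wedge_basis (l : 'I_('C(n, j))) :
  wedge (fun q => basis_vec R (tnth (incr l) q)) = delta_mx l 0.
Proof.
apply/matrixP => k z; rewrite {z}ord1 !mxE eqxx andbT.
have [->|kl] := eqVneq k l.
  rewrite (_ : \matrix_(_, _) _ = 1%:M) ?det1 //.
  apply/matrixP => p q; rewrite !mxE eqxx andbT; congr (_%:R); congr nat_of_bool.
  by apply/eqP/eqP => [|-> //]; apply: tuple_uniqP; apply: incr_uniq.
have [p kp] : exists p, tnth (incr k) p \notin incr l.
  apply/existsP; apply: contraNT kl; rewrite negb_exists => /forallP kl.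
  have sub : {subset incr k <= incr l}.
    by move=> _ /tnthP[p ->]; have := kl p; rewrite negbK.
  apply/eqP/incr_mem_inj.
  by have [] := uniq_min_size (incr_uniq k) sub; rewrite ?size_tuple.
rewrite (expand_det_row _ p) big1 // => q _.
rewrite !mxE eqxx andbT (_ : _ == _ = false) ?mul0r //.
by apply: contraNF kp => /eqP ->; apply: mem_tnth.
Qed.

End ExteriorPowerTheory.

Definition generalized_even_oscillatory (R : realType) (n : nat)
    (A : 'M[R]_n) : Prop :=
  forall j : nat, (1 <= j <= n)%N -> ~~ odd j ->
  exists K : set 'cV[R]_('C(n, j)),
    proper_cone K /\ cone_primitive K (ext_power j A).

Definition complexify (R : realType) (n : nat) (A : 'M[R]_n) : 'M[R[i]]_n :=
  map_mx (real_complex R) A.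

(* The norm of R[i] takes its values in R[i]; Re brings it back to R. *)
Definition spectral_radius (R : realType) (n : nat) (A : 'M[R]_n) : R :=
  sup [set complex.Re `|z| | z in [set z | eigenvalue (complexify A) z]].

(* Principal argument, in ]-pi, pi]; the value at 0 is meaningless. *)
Definition arg (R : realType) (z : R[i]) : R :=
  let t := acos (complex.Re z / complex.Re `|z|) in
  if 0 <= complex.Im z then t else - t.

Lemma arg_spec (R : realType) (z : R[i]) : z != 0 ->
  - pi < arg z <= pi /\
  z = `|z| * (Complex (cos (arg z)) (sin (arg z))).
Proof.
case: z => a b z0; rewrite normc_def /arg /=.
set r := Num.sqrt _.
have r2 : r ^+ 2 = a ^+ 2 + b ^+ 2 by rewrite sqr_sqrtr // addr_ge0 ?sqr_ge0.
have r0 : 0 < r.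
  rewrite sqrtr_gt0 lt_neqAle addr_ge0 ?sqr_ge0 // andbT eq_sym.
  rewrite paddr_eq0 ?sqr_ge0 // !sqrf_eq0.
  by apply: contra z0 => /andP[/eqP -> /eqP ->].
have rn0 : r != 0 by rewrite gt_eqF.
have ar1 : (a / r) ^+ 2 + (b / r) ^+ 2 = 1.
  by rewrite !expr_div_n -mulrDl -r2 divff // expf_neq0.
have car : -1 <= a / r <= 1.
  rewrite -ler_norml -(@ler_pXn2r _ 2) ?nnegrE // expr1n real_normK ?num_real //.
  by rewrite -ar1 lerDl sqr_ge0.
have sin_t : sin (acos (a / r)) = `|b| / r.
  have e : 1 - (a / r) ^+ 2 = (b / r) ^+ 2 by rewrite -ar1 addrC addKr.
  by rewrite sin_acos // e sqrtr_sqr normrM normfV (gtr0_norm r0).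
have t_ge0 := acos_ge0 car; have t_le := acos_lepi car.
have cos_t : cos (acos (a / r)) = a / r by rewrite acosK // in_itv.
case: (leP 0 b) => b0.
  split; first by rewrite t_le andbT (lt_le_trans _ t_ge0) // oppr_lt0 pi_gt0.
  rewrite cos_t sin_t ger0_norm // /GRing.mul /=.
  by rewrite !mul0r subr0 addr0 ![r * _]mulrC !divfK.
split.
  have ->: - acos (a / r) <= pi.
    by apply: (@le_trans _ _ 0); rewrite ?oppr_le0 // pi_ge0.
  rewrite andbT ltrN2 acos_ltpi //.
  have/andP[] := car; rewrite le_eqVlt => /orP[/eqP ar _|-> ->//].
  move: ar1; rewrite -ar sqrrN expr1n -[RHS]addr0 => /addrI/eqP.
  by rewrite sqrf_eq0 mulf_eq0 invr_eq0 (negbTE rn0) orbF lt_eqF.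
rewrite cosN sinN cos_t sin_t ltr0_norm // /GRing.mul /=.
by rewrite !mul0r subr0 addr0 -mulNr opprK ![r * _]mulrC !divfK.
Qed.

(* Main.v *)
(* The j-th compound of a matrix similar to a triangular T is similar to the
   compound of T, which is again triangular for a suitable order; hence the
   eigenvalues of the j-th exterior power are the products of j distinctly
   indexed eigenvalues of A.

   For a K-primitive B, the largest t such that B x - t x lies in K for some
   nonzero x of K (Collatz-Wielandt) is an eigenvalue r > 0 with an eigenvector
   v interior to K.  By compactness some power of B / r moves every y of K into
   e |y| v + K for a fixed e > 0, so it contracts the oscillation of vectors
   relative to v.  If B w = z w + a v with |z| >= r, the real parts of all
   u w, |u| <= 1, then have oscillation 0, so w is a multiple of v.  Deflating
   B by v, every root of the characteristic polynomial but one simple root r has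
   modulus smaller than r.

   For even j the product of some j eigenvalues is thus positive and strictly
   larger in modulus than all the others.  An exchange argument shows that it is
   lambda_1 ... lambda_j; comparison with lambda_1 ... lambda_(j-1) lambda_(j+1)
   gives |lambda_j| > |lambda_(j+1)|, and dividing consecutive even products
   gives lambda_(j-1) lambda_j > 0. *)

Require Import Defs.
From HB Require Import structures.
From mathcomp Require Import all_boot all_order all_algebra all_fingroup.
From mathcomp Require Import all_classical all_reals all_analysis.
From mathcomp Require Import complex zify ring lra.
Set Implicit Arguments.
Unset Strict Implicit.
Unset Printing Implicit Defensive.
Import Order.TTheory GRing.Theory Num.Theory.
Import numFieldNormedType.Exports.
Local Open Scope ring_scope.

(** * Characteristic polynomials of compound matrices *)

(** A nonzero Leibniz term needs [w (s i) < w i] wherever [s] moves [i], while the sums of [w (s i)]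
    and of [w i] agree; so only the identity contributes. Weights may tie, hence no total order on
    index sets has to be chosen for compounds. *)
Lemma det_weight_trig (F : comNzRingType) (n : nat) (w : 'I_n -> nat)
    (M : 'M[F]_n) :
  (forall i k, i != k -> (w i <= w k)%N -> M i k = 0) ->
  \det M = \prod_i M i i.
Proof.
move=> M0; rewrite /determinant (bigD1 1%g) //= [X in _ + X]big1 ?addr0.
  by rewrite odd_perm1 mul1r; apply: eq_bigr => i _; rewrite perm1.
move=> s s1; suff [i si wi] : exists2 i, i != s i & (w i <= w (s i))%N.
  by rewrite (bigD1 i) //= M0 // mul0r mulr0.
apply/exists_inP; apply: contraNT s1; rewrite negb_exists_in => /forall_inP ws.
have le i : (w (s i) <= w i)%N.
  by have [/eqP <-//|/ws] := boolP (i == s i); rewrite -ltnNge => /ltnW.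
have /leqif_sum : forall i, true -> (w (s i) <= w i ?= iff (w (s i) == w i))%N.
  by move=> i _; split.
move=> [_]; rewrite [X in _ == X](reindex_perm s) eqxx => /esym/forallP eqw.
apply/eqP/permP => i; rewrite perm1; apply/eqP; apply: contraT.
rewrite eq_sym => /ws; rewrite -ltnNge; have /= /eqP -> := eqw i.
by rewrite ltnn.
Qed.

Lemma char_poly_weight_trig (F : comNzRingType) (n : nat) (w : 'I_n -> nat)
    (M : 'M[F]_n) :
  (forall i k, i != k -> (w i <= w k)%N -> M i k = 0) ->
  char_poly M = \prod_i ('X - (M i i)%:P).
Proof.
move=> M0; rewrite /char_poly (@det_weight_trig _ _ w) => [|i k ik wik].
  by apply: eq_bigr => i _; rewrite !mxE eqxx mulr1n.
by rewrite !mxE (negbTE ik) mulr0n M0 // polyC0 subr0.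
Qed.

Lemma char_poly_similar (F : comNzRingType) (n : nat) (P Q M : 'M[F]_n) :
  P *m Q = 1%:M -> char_poly (P *m M *m Q) = char_poly M.
Proof.
move=> PQ; rewrite /char_poly.
pose Pc := map_mx (@polyC F) P; pose Qc := map_mx (@polyC F) Q.
have PQc : Pc *m Qc = 1%:M by rewrite -map_mxM PQ map_mx1.
have -> : char_poly_mx (P *m M *m Q) = Pc *m char_poly_mx M *m Qc.
  rewrite /char_poly_mx !map_mxM mulmxBr mulmxBl.
  by rewrite scalar_mxC -(mulmxA _ Pc) PQc mulmx1.
rewrite !det_mulmx mulrAC -det_mulmx PQc det1 mul1r //.
Qed.

(** Stated over any commutative ring, so that the exterior power of a real matrix can be carried to
    the complex field and triangularised there. *)
Definition compound (F : comNzRingType) (n j : nat) (M : 'M[F]_n) :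
    'M[F]_('C(n, j)) :=
  \matrix_(k, l) \det (mxsub (tnth (incr k)) (tnth (incr l)) M).

(** Cauchy-Binet over a general ring: expand by multilinearity, drop the non-injective maps, and
    write each injective one as an increasing sequence composed with a permutation. *)
Lemma det_mulmx_minors (F : comNzRingType) (n j : nat) (M : 'M[F]_(j, n))
    (X : 'M[F]_(n, j)) :
  \det (M *m X) =
  \sum_(l < 'C(n, j)) \det (colsub (tnth (incr l)) M) *
                      \det (rowsub (tnth (incr l)) X).
Proof.
pose G (f : {ffun 'I_j -> 'I_n}) := (\prod_p M p (f p)) * \det (rowsub f X).
have -> : \det (M *m X) = \sum_f G f.
  pose H (s : 'S_j) (f : {ffun 'I_j -> 'I_n}) :=
    (-1) ^+ s * \prod_p (M p (f p) * X (f p) (s p)).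
  transitivity (\sum_s \sum_f H s f).
    apply: eq_bigr => s _; rewrite /H -mulr_sumr; congr (_ * _).
    by under eq_bigr do rewrite mxE; rewrite bigA_distr_bigA.
  rewrite exchange_big; apply: eq_bigr => f _; rewrite /G mulr_sumr.
  apply: eq_bigr => s _; rewrite /H big_split mulrCA; do 2 congr (_ * _).
  by apply: eq_bigr => p _; rewrite mxE.
rewrite (bigID (mem [set f : {ffun 'I_j -> 'I_n} | injectiveb f]%SET)) /=.
rewrite [X in _ + X]big1 ?addr0 => [|f]; last first.
  rewrite inE => /injectivePn[p [q pq fpq]]; rewrite /G.
  by rewrite (determinant_alternate pq) ?mulr0 // => r; rewrite !mxE fpq.
rewrite -incr_perm_imset big_imset => [|? ? _ _]; last exact: incr_perm_inj.
rewrite (eq_bigl xpredT) => [|ls]; last by rewrite inE.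
rewrite (eq_bigr (fun ls => G (incr_perm (ls.1, ls.2)))) => [|[]//].
rewrite -(pair_bigA _ (fun l s => G (incr_perm (l, s)))) /=.
apply: eq_bigr => l _; rewrite [in RHS]/determinant mulr_suml.
apply: eq_bigr => s _; rewrite /G.
have -> : rowsub (incr_perm (l, s)) X = row_perm s (rowsub (tnth (incr l)) X).
  by apply/matrixP => p q; rewrite !mxE ffunE.
rewrite row_permE det_mulmx det_perm mulrCA mulrA; congr (_ * _ * _).
by apply: eq_bigr => p _; rewrite !mxE ffunE.
Qed.

Lemma compoundM (F : comNzRingType) (n j : nat) (M N : 'M[F]_n) :
  compound j (M *m N) = compound j M *m compound j N.
Proof.
apply/matrixP => k l; rewrite !mxE mxsub_mul det_mulmx_minors.
apply: eq_bigr => i _; rewrite !mxE; congr (_ * _);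
  congr (determinant _);
  by apply/matrixP => p q; rewrite !mxE.
Qed.

Lemma det_neq0_transversal (F : comNzRingType) (n : nat) (M : 'M[F]_n) :
  \det M != 0 -> exists s : 'S_n, forall p, M p (s p) != 0.
Proof.
move=> dM.
suff /existsP[s /forallP] : [exists s : 'S_n, [forall p, M p (s p) != 0]].
  by exists s.
apply: contraNT dM; rewrite negb_exists.
move=> /forallP Ms; apply/eqP/big1 => s _.
have := Ms s; rewrite negb_forall => /existsP[p]; rewrite negbK => /eqP Mp.
by rewrite (bigD1 p) //= Mp mul0r mulr0.
Qed.

Lemma incr_eq_perm (n j : nat) (k l : 'I_('C(n, j))) (s : 'S_j) :
  (forall p, tnth (incr k) p = tnth (incr l) (s p)) -> k = l.
Proof.
move=> kl; apply: incr_mem_inj => i; apply/tnthP/tnthP => -[p ->].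
  by exists (s p).
by exists ((s^-1)%g p); rewrite kl permKV.
Qed.

Lemma compound1 (F : comNzRingType) (n j : nat) :
  compound j (1%:M : 'M[F]_n) = 1%:M.
Proof.
apply/matrixP => k l; rewrite !mxE; have [->|kl] := eqVneq k l.
  rewrite (_ : mxsub _ _ _ = 1%:M) ?det1 //.
  apply/matrixP => p q; rewrite !mxE; congr (_%:R); congr nat_of_bool.
  by apply/eqP/eqP => [|-> //]; apply: tuple_uniqP; apply: incr_uniq.
apply/eqP; apply: contraNT kl => /det_neq0_transversal[s ps].
apply/eqP; apply: (@incr_eq_perm _ _ _ _ s) => p; apply/eqP; have := ps p.
by rewrite !mxE; apply: contraNT => /negbTE ->.
Qed.

(** Schur's theorem gives a triangular [T] whose diagonal is some rearrangement [s] of [lam].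
    Conjugating by the permutation matrix puts [lam i] at place [i]; the triangular shape survives
    as the weight [s]. *)
Lemma weight_trig_similar (C : numClosedFieldType) (n : nat) (M : 'M[C]_n)
    (lam : 'I_n -> C) :
  char_poly M = \prod_i ('X - (lam i)%:P) ->
  exists P Q : 'M[C]_n, exists w : 'I_n -> nat,
    [/\ P *m Q = 1%:M,
        forall i k, i != k -> (w i <= w k)%N -> (P *m M *m Q) i k = 0
      & forall i, (P *m M *m Q) i i = lam i].
Proof.
case: n M lam => [|n] M lam Mlam.
  by exists 1%:M, 1%:M, (fun=> 0%N); split; rewrite ?mul1mx //; case.
have [P Pu PT] := Schur M (ltn0Sn n).
have {}Pu : P \in unitmx := unitarymx_unit Pu.
have {}PT : is_trig_mx (P *m M *m invmx P) by rewrite -conjumx.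
set T := P *m M *m invmx P in PT.
have /tuple_permP[s Es] :
    perm_eq [tuple lam i | i < n.+1] [tuple T i i | i < n.+1].
  apply: prod_XsubC_eq; rewrite !big_tuple.
  under eq_bigr do rewrite tnth_mktuple.
  under [RHS]eq_bigr do rewrite tnth_mktuple.
  by rewrite -Mlam -char_poly_trig // char_poly_similar // mulmxV.
have lamE i : lam i = T (s i) (s i).
  by have /(congr1 (fun t => tnth t i)) := val_inj Es; rewrite !tnth_mktuple.
pose U := perm_mx s : 'M[C]_n.+1.
have UTE i k : (U *m T *m U^T) i k = T (s i) (s k).
  by rewrite /U tr_perm_mx -row_permE -col_permE !mxE.
have PTE : U *m P *m M *m (invmx P *m U^T) = U *m T *m U^T.
  by rewrite /T !mulmxA.
exists (U *m P), (invmx P *m U^T), (fun i => val (s i)); split.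
- by rewrite mulmxA mulmxK // tr_perm_mx -perm_mxM mulgV perm_mx1.
- move=> i k ik sik; rewrite PTE UTE; apply: (is_trig_mxP PT).
  by rewrite ltn_neqAle sik andbT; apply: contra ik => /eqP/val_inj/perm_inj->.
- by move=> i; rewrite PTE UTE.
Qed.

Theorem char_poly_compound (C : numClosedFieldType) (n j : nat) (M : 'M[C]_n)
    (lam : 'I_n -> C) :
  char_poly M = \prod_i ('X - (lam i)%:P) ->
  char_poly (compound j M) =
  \prod_(l < 'C(n, j)) ('X - (\prod_(i <- incr l) lam i)%:P).
Proof.
move=> /weight_trig_similar[P [Q [w [PQ wT Tlam]]]].
rewrite -(@char_poly_similar _ _ (compound j P) (compound j Q)); last first.
  by rewrite -compoundM PQ compound1.
rewrite -!compoundM; set T := P *m M *m Q in wT Tlam *.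
(* An index set weighs as much as its elements together; each diagonal minor of [T] is itself
   triangular for [w]. *)
rewrite (@char_poly_weight_trig _ _ (fun k => \sum_(i <- incr k) w i)%N).
  apply: eq_bigr => l _; congr ('X - _%:P).
  rewrite mxE (@det_weight_trig _ _ (fun p => w (tnth (incr l) p))).
    by rewrite big_tuple; apply: eq_bigr => p _; rewrite mxE Tlam.
  move=> p q pq wpq; rewrite mxE wT //; apply: contra pq.
  by move=> /eqP/tuple_uniqP -> //; apply: incr_uniq.
(* A nonzero minor of T has a nonzero transversal, along which w can only drop:
   its row indices weigh at least as much as its column indices. *)
move=> k l kl wkl; apply/eqP; apply: contraTT wkl; rewrite mxE.
move=> /det_neq0_transversal[s]; rewrite -ltnNge => Ts.
have kls p : tnth (incr k) p != tnth (incr l) (s p) ->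
    (w (tnth (incr l) (s p)) < w (tnth (incr k) p))%N.
  by move=> pq; have := Ts p; rewrite mxE ltnNge; apply: contra => /wT ->.
have le p : (w (tnth (incr l) (s p)) <= w (tnth (incr k) p))%N.
  by have [->//|/kls/ltnW] := eqVneq (tnth (incr k) p) (tnth (incr l) (s p)).
rewrite !big_tuple (reindex_perm s) /= ltn_neqAle leq_sum // andbT.
apply: contra kl => eqw; apply/eqP; apply: (@incr_eq_perm _ _ _ _ s) => p.
apply/eqP; apply: contraTT eqw => /kls lt.
rewrite neq_ltn (bigD1 p) //= [in ltnRHS](bigD1 p) //= -addSn.
by rewrite leq_add // leq_sum.
Qed.

Lemma ext_powerE (R : realType) (n j : nat) (A : 'M[R]_n) :
  ext_power j A = compound j A.
Proof.
apply/matrixP => k l; rewrite !mxE; congr (\det _); apply/matrixP => p q.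
by rewrite mxE [RHS]mxE /basis_vec -colE mxE.
Qed.

Lemma map_compound (F G : comNzRingType) (f : {rmorphism F -> G}) (n j : nat)
    (M : 'M[F]_n) :
  map_mx f (compound j M) = compound j (map_mx f M).
Proof. by apply/matrixP => k l; rewrite !mxE -det_map_mx map_mxsub. Qed.

Lemma char_poly_ext_power (R : realType) (n j : nat) (A : 'M[R]_n)
    (lam : 'I_n -> R[i]) :
  char_poly (complexify A) = \prod_i ('X - (lam i)%:P) ->
  char_poly (complexify (ext_power j A)) =
  \prod_(l < 'C(n, j)) ('X - (\prod_(i <- incr l) lam i)%:P).
Proof.
by rewrite ext_powerE /complexify map_compound; apply: char_poly_compound.
Qed.

(** * Deflation by an eigenvector *)

Lemma char_poly_trmx (F : comNzRingType) (n : nat) (M : 'M[F]_n) :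
  char_poly M^T = char_poly M.
Proof.
rewrite /char_poly -det_tr; congr (\det _).
by rewrite /char_poly_mx linearB /= tr_scalar_mx map_trmx trmxK.
Qed.

(* In a basis starting with v the matrix is block triangular with blocks r and
   M'; q is the characteristic polynomial of M', and w lifts an eigenvector
   of M'. *)
Lemma char_poly_deflate (F : fieldType) (n : nat) (M : 'M[F]_n) (v : 'cV[F]_n)
    (r : F) :
  v != 0 -> M *m v = r *: v ->
  exists2 q : {poly F}, char_poly M = ('X - r%:P) * q &
    forall z, root q z -> exists w : 'cV[F]_n, exists a : F,
      M *m w = z *: w + a *: v /\ forall b, w != b *: v.
Proof.
case: n M v => [|n] M v v0 Mv; first by rewrite [v]flatmx0 eqxx in v0.
pose P := row_ebase v^T : 'M[F]_(1 + n).
have Pu : P \in unitmx := row_ebase_unit _.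
pose e : 'rV[F]_(1 + n) := pid_mx 1.
have eE : e = row_mx 1%:M 0 := pid_mx_row _ _ _.
(* [v^T] has rank one, so it is a nonzero multiple of the first row of [P]. *)
have [c c0 vP] : exists2 c, c != 0 & v^T = c *: (e *m P).
  have rv : \rank (v^T) = 1%N by rewrite rank_rV trmx_eq0 v0.
  have Ev : v^T = (col_ebase v^T) 0 0 *: (e *m P).
    rewrite -{1}(mulmx_ebase v^T) rv -mulmxA.
    by rewrite {1}[col_ebase _]mx11_scalar mul_scalar_mx.
  exists ((col_ebase v^T) 0 0) => //.
  by apply: contraNneq v0 => c0; rewrite -trmx_eq0 Ev c0 scale0r.
pose T := P *m M^T *m invmx P.
have eT : e *m T = r *: e.
  have -> : e = c^-1 *: (v^T *m invmx P).
    by rewrite vP -scalemxAl mulmxK // scalerA mulVf ?scale1r.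
  rewrite -scalemxAl /T !mulmxA mulmxKV // -trmx_mul Mv linearZ /=.
  by rewrite -scalemxAl !scalerA mulrC.
have Tblock : T = block_mx r%:M 0 (dlsubmx T) (drsubmx T).
  have := eT; rewrite -{1}[T]submxK eE mul_row_block !mul1mx !mul0mx !addr0.
  rewrite scale_row_mx scaler0 scalemx1 => /eq_row_mx[Tul Tur].
  by rewrite -Tul -Tur submxK.
exists (char_poly (drsubmx T)).
  rewrite -char_poly_trmx -(@char_poly_similar _ _ P (invmx P)) ?mulmxV //.
  rewrite -/T {1}Tblock /char_poly /char_poly_mx map_block_mx /= map_mx0.
  rewrite [X in X - _](@scalar_mx_block _ 1 n) opp_block_mx add_block_mx.
  by rewrite oppr0 addr0 det_lblock det_mx11 !mxE eqxx !mulr1n.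
move=> z; rewrite -eigenvalue_root_char => /eigenvalueP[y yT y0].
have wP : row_mx 0 y *m P *m M^T =
    z *: (row_mx 0 y *m P) + (c^-1 * (y *m dlsubmx T) 0 0) *: v^T.
  have -> : row_mx 0 y *m P *m M^T = row_mx 0 y *m T *m P.
    by rewrite /T !mulmxA mulmxKV.
  rewrite {1}Tblock mul_row_block !mul0mx !add0r yT vP scalerA mulrAC mulVf //.
  rewrite mul1r scalemxAl [X in _ + X]scalemxAl -mulmxDl eE.
  rewrite !scale_row_mx scalemx1 !scaler0 add_row_mx add0r addr0.
  by rewrite -mx11_scalar.
exists (row_mx 0 y *m P)^T, (c^-1 * (y *m dlsubmx T) 0 0); split.
  by apply: trmx_inj; rewrite trmx_mul trmxK wP linearD /= !linearZ /= trmxK.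
move=> b; apply: contra y0 => /eqP/(congr1 trmx).
rewrite trmxK linearZ /= vP scalerA scalemxAl => /(can_inj (mulmxK Pu)).
by rewrite eE scale_row_mx scaler0 => /eq_row_mx[_ ->].
Qed.

Local Open Scope classical_set_scope.

(** * Proper cones *)

Lemma mx_entry_le_norm (R : realType) (m n : nat) (M : 'M[R]_(m, n)) i j :
  `|M i j| <= `|M|.
Proof.
rewrite [leRHS]/Num.Def.normr /= mx_normrE; apply/bigmax_geP; right.
by exists (i, j).
Qed.

Lemma mx_norm_le (R : realType) (m n : nat) (M : 'M[R]_(m, n)) c :
  0 <= c -> (forall i j, `|M i j| <= c) -> `|M| <= c.
Proof.
move=> c0 Mc; rewrite [leLHS]/Num.Def.normr /= mx_normrE; apply/bigmax_leP.
by split=> // -[i j] _; apply: Mc.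
Qed.

Lemma continuous_linear_le (R : realType) (V W : normedModType R)
    (f : {linear V -> W}) c :
  (forall x, `|f x| <= c * `|x|) -> continuous f.
Proof.
move=> fc; apply/linear_bounded_continuous/linear_boundedP.
near=> r => x; apply: le_trans (fc x) _; apply: ler_wpM2r => //.
Unshelve. all: by end_near. Qed.

Lemma mulmx_continuous (R : realType) (m n p : nat) (B : 'M[R]_(m, n)) :
  continuous (fun x : 'M[R]_(n, p) => B *m x).
Proof.
apply: (@continuous_linear_le _ _ _ (mulmx B) (n%:R * `|B|)) => x.
apply: mx_norm_le => [|i j]; first by rewrite !mulr_ge0.
rewrite mxE; apply: le_trans (ler_norm_sum _ _ _) _.
have -> : n%:R * `|B| * `|x| = \sum_(k < n) `|B| * `|x|.
  by rewrite sumr_const card_ord -[RHS]mulr_natl mulrA.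
by apply: ler_sum => k _; rewrite normrM ler_pM ?mx_entry_le_norm.
Qed.

Lemma trmx_continuous (R : realType) (m n : nat) :
  continuous (@trmx R m n).
Proof.
apply: (@continuous_linear_le _ _ _ (@trmx R m n) 1) => x.
by apply: mx_norm_le => [|i j]; rewrite mul1r // mxE mx_entry_le_norm.
Qed.

(** Heine-Borel for row vectors, transported by transposition. *)
Lemma col_bounded_closed_compact (R : realType) (n : nat) (A : set 'cV[R]_n) :
  bounded_set A -> closed A -> compact A.
Proof.
move=> bA cA; have -> : A = trmx @` (trmx @^-1` A).
  apply/seteqP; split=> [x Ax|_ [x Ax <-]//].
  by exists x^T; rewrite /= trmxK.
apply: continuous_compact.
  by apply: continuous_subspaceT; apply: trmx_continuous.
apply: bounded_closed_compact.
  have [M [Mr AM]] := bA; exists M; split=> // c Mc x /= /(AM c Mc) /=.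
  apply: le_trans; apply: mx_norm_le => // i j.
  by have := mx_entry_le_norm x^T j i; rewrite mxE.
by apply: preimage_closed => // x _; apply: trmx_continuous.
Qed.

Lemma nbhs_scale (R : realType) (V : normedModType R) (A : set V) (a : R)
    (x : V) :
  a != 0 -> nbhs x A -> \forall z \near a *: x, A (a^-1 *: z).
Proof.
move=> a0 Ax; have : (fun z => a^-1 *: z) @ (a *: x) --> x.
  by rewrite -[X in _ --> X](scalerK a0); apply: cvgZr; exact: cvg_id.
exact.
Qed.

Lemma affine_continuous (R : realType) (V : normedModType R) (v y : V) :
  continuous (fun t : R => v + t *: y).
Proof.
by move=> t; apply: cvgD; [exact: cvg_cst|apply: cvgZl; exact: cvg_id].
Qed.

Lemma harmonic_scale_cvg (R : realType) (V : normedModType R) (x y : V) :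
  harmonic n *: x + y @[n --> \oo] --> y.
Proof.
rewrite -[X in _ --> X]add0r -(scale0r x); apply: cvgD; last exact: cvg_cst.
by apply: cvgZl; exact: cvg_harmonic.
Qed.

Section ProperCone.
Variables (R : realType) (N : nat) (K : set 'cV[R]_N).
Hypothesis hK : proper_cone K.
Implicit Types (x y v : 'cV[R]_N) (B : 'M[R]_N).

Lemma coneD x y : K x -> K y -> K (x + y).
Proof. by have [+ _ _ _ _] := hK; apply. Qed.

Lemma coneZ (a : R) x : 0 <= a -> K x -> K (a *: x).
Proof. by have [_ + _ _ _] := hK; apply. Qed.

Lemma cone_closed : closed K. Proof. by case: hK. Qed.

Lemma cone_interiorP : exists v, interior K v.
Proof. by case: hK. Qed.

Lemma cone0 : K 0.
Proof.
have [v /interior_subset Kv] := cone_interiorP.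
by rewrite -(scale0r v); apply: coneZ.
Qed.

Lemma cone_pointed x : K x -> K (- x) -> x = 0.
Proof.
case: hK => _ _ K0 _ _ Kx KNx; suff : [set 0] x by [].
by rewrite -K0; split=> //; exists (- x) => //; rewrite opprK.
Qed.

Lemma cone_interiorZ (a : R) x : 0 < a -> interior K x -> interior K (a *: x).
Proof.
move=> a0 Kx; apply: filterS (nbhs_scale (lt0r_neq0 a0) Kx) => z Kz.
by rewrite -(scalerKV (lt0r_neq0 a0) z); apply: coneZ => //; apply: ltW.
Qed.

(** If a ball of radius [e] around [v] lies in [K], then [v] may be perturbed by a multiple of [x]
    of norm [e / 2]; rescaling gives [c = 2 / e]. *)
Lemma cone_order_unit v : interior K v ->
  exists2 c : R, 0 < c & forall x, K ((c * `|x|) *: v + x).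
Proof.
move=> Kv; have /nbhs_normP[e /= e0 Ke] : nbhs v K := Kv.
exists (2 / e) => [|x]; first by rewrite divr_gt0.
have [->|x0] := eqVneq x 0.
  by rewrite normr0 mulr0 scale0r addr0; exact: cone0.
have nx : 0 < `|x| by rewrite normr_gt0.
pose d := 2 / e * `|x|; have d0 : 0 < d by rewrite !mulr_gt0 ?invr_gt0.
have -> : d *: v + x = d *: (v + d^-1 *: x).
  by rewrite scalerDr scalerA mulfV ?scale1r ?gt_eqF.
apply: coneZ; first exact: ltW.
apply: Ke => /=; rewrite opprD addNKr normrN normrZ gtr0_norm ?invr_gt0 //.
rewrite /d invfM -mulrA mulVf ?gt_eqF // mulr1 invf_div.
lra.
Qed.

Lemma cone_limit x y : (forall e : R, 0 < e -> K (e *: x + y)) -> K y.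
Proof.
move=> Ke; have := @harmonic_scale_cvg R _ x y.
apply: (@closed_cvg _ _ _ _ _ K cone_closed).
by apply: nearW => n; apply: Ke; rewrite /harmonic /= invr_gt0.
Qed.

Lemma basis_vec_neq0 (i : 'I_N) : basis_vec R i != 0.
Proof.
by apply/eqP => /matrixP/(_ i 0)/eqP; rewrite !mxE !eqxx oner_eq0.
Qed.

(** If 0 were interior, the order unit property would put every vector in [K], against
    pointedness. *)
Lemma cone_interior_coord v : (0 < N)%N -> interior K v -> exists i, v i 0 != 0.
Proof.
move=> N0 Kv; apply/existsP; apply: contraPT Kv.
rewrite negb_exists => /forallP v0 Kv.
have {}v0 : v = 0.
  apply/colP => i; apply/eqP; rewrite mxE; have := v0 i.
  by rewrite negbK.
have [c _ Kc] := cone_order_unit Kv.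
have /eqP := basis_vec_neq0 (Ordinal N0); apply.
have Kx x : K x by have := Kc x; rewrite v0 scaler0 add0r.
exact: cone_pointed.
Qed.

(** A line through the interior point [v] in a suitable basis direction [y] avoids 0. If all nonzero
    points of [K] were interior, the line would meet [K] in a nonempty set both open and closed,
    hence lie in [K]; then [y] and [- y] would be in [K]. *)
Lemma cone_boundary_neq0 : (1 < N)%N -> exists2 x, x != 0 & boundary K x.
Proof.
move=> N1.
have [v Kv] := cone_interiorP.
have [i vi] := cone_interior_coord (ltnW N1) Kv.
have [j ji] : exists j : 'I_N, j != i.
  apply/existsP; apply: contraLR N1; rewrite negb_exists => /forallP ji.
  rewrite -leqNgt -[N]card_ord -(card1 i) subset_leq_card //.
  by apply/fintype.subsetP => j _; have := ji j; rewrite negbK.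
pose y := basis_vec R j.
have vy0 (t : R) : v + t *: y != 0.
  apply: contra vi => /eqP/matrixP/(_ i 0)/eqP.
  by rewrite !mxE [i == j]eq_sym (negbTE ji) mulr0 addr0.
apply: contrapT => nex.
have bd x : x != 0 -> K x -> interior K x.
  move=> x0 Kx; apply: contrapT => nKx; apply: nex; exists x => //.
  by split=> //; apply: subset_closure.
pose f (t : R) : 'cV[R]_N := v + t *: y.
have cf : continuous f by exact: affine_continuous.
have KT : f @^-1` K = setT.
  have /connected_intervalP : is_interval [set: R] by [].
  apply; first by exists 0; rewrite /f /= scale0r addr0; apply: interior_subset.
    exists (f @^-1` interior K).
      by apply: open_comp => [t _|]; [exact: cf|exact: open_interior].
    rewrite setTI; apply/seteqP; split=> t /=; last exact: interior_subset.
    exact/bd/vy0.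
  exists (f @^-1` K); last by rewrite setTI.
  by apply: preimage_closed => [t _|]; [exact: cf|exact: cone_closed].
have Kf t : K (f t) by have : [set: R] t by []; rewrite -KT.
have /eqP := basis_vec_neq0 j; apply; apply: cone_pointed.
  apply: (@cone_limit v) => e e0.
  have -> : e *: v + y = e *: f e^-1.
    by rewrite scalerDr scalerA mulfV ?scale1r ?gt_eqF.
  by apply: coneZ => //; apply: ltW.
apply: (@cone_limit v) => e e0.
have -> : e *: v - y = e *: f (- e^-1).
  by rewrite scalerDr scalerA mulrN mulfV ?scaleN1r ?gt_eqF.
by apply: coneZ => //; apply: ltW.
Qed.

Definition cone_base : set 'cV[R]_N := [set x | K x /\ `|x| = 1].

Lemma cone_base_compact : compact cone_base.
Proof.
apply: col_bounded_closed_compact.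
  by exists 1; split=> [|c c1 x [_ x1]]; rewrite ?num_real //= x1 ltW.
apply: (@closedI _ K [set x | `|x| = 1]); first exact: cone_closed.
apply: (@preimage_closed _ _ (fun x : 'cV[R]_N => `|x|) [set 1]).
  by move=> x _; apply: norm_continuous.
exact: closed_eq.
Qed.

End ProperCone.

(** * Spectral gap of primitive operators *)

(** Joint continuity in the form that the compactness arguments below need: the neighbourhood of [s]
    can then be made uniform over the base of the cone. *)
Lemma near_affine_pair (R : realType) (V : normedModType R) (f g : V -> V)
    (A : set V) (x : V) (s : R) :
  continuous f -> continuous g -> nbhs (f x - s *: g x) A ->
  \forall y \near x & t \near s, A (f y - t *: g y).
Proof.
move=> cf cg Ax.
have : (fun p : V * R => f p.1 - p.2 *: g p.1) @ (nbhs (x, s)) -->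
    f x - s *: g x.
  have fstx (h : V -> V) : continuous h ->
      (fun p : V * R => h p.1) @ (nbhs (x, s)) --> h x.
    move=> ch; apply: (@cvg_comp _ _ _ fst h _ (nbhs x) _ cvg_fst).
    exact: ch.
  by apply: cvgB; [exact: fstx|apply: cvgZ; [exact: cvg_snd|exact: fstx]].
exact.
Qed.

Section PrimitiveOperator.
Variables (R : realType) (N : nat) (K : set 'cV[R]_N) (B : 'M[R]_N).
Hypotheses (hK : proper_cone K) (hB : cone_primitive K B) (N_gt0 : (0 < N)%N).
Implicit Types (x y v : 'cV[R]_N).

Lemma primitive_stable x : K x -> K (B *m x).
Proof. by case: hB => BK _ _ Kx; apply: BK; exists x. Qed.

Lemma primitive_stable_exp k x : K x -> K (B ^+ k *m x).
Proof.
move=> Kx; elim: k => [|k IHk]; first by rewrite expr0 mul1mx.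
by rewrite exprS -mulmxA; apply: primitive_stable.
Qed.

(** An orbit staying on the boundary would be a nonempty invariant subset of it containing
    [x != 0]. *)
Lemma primitive_orbit_interior x :
  K x -> x != 0 -> exists k, interior K (B ^+ k *m x).
Proof.
move=> Kx x0; apply: contrapT => nK.
have [_ /(_ (range (fun k => B ^+ k *m x)))[orbit0 _] _] := hB.
suff /orbit0 S0 : [/\ range (fun k => B ^+ k *m x) !=set0,
    range (fun k => B ^+ k *m x) `<=` boundary K
  & invariant_set B (range (fun k => B ^+ k *m x))].
  have : range (fun k => B ^+ k *m x) x.
    by exists 0%N => //; rewrite expr0 mul1mx.
  by rewrite S0 => /= /eqP; apply/negP.
split; first by exists x, 0%N => //; rewrite expr0 mul1mx.
  move=> _ [k _ <-]; split; first exact/subset_closure/primitive_stable_exp.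
  by move=> Kk; apply: nK; exists k.
by move=> _ [_ [k _ <-] <-]; exists k.+1 => //; rewrite exprS -mulmxA.
Qed.

Lemma primitive_neq0 : B != 0.
Proof.
have [N1|N1] := leqP N 1.
  by case: hB => _ _; apply; apply/eqP; rewrite eqn_leq N1.
apply/eqP => B0; have [x x0 bx] := cone_boundary_neq0 hK N1.
(* The equivalence in [cone_primitive], read from right to left, says that [[set 0]] lies in the
   boundary. For [B = 0] the pair [[set 0; x]] would be a second invariant subset. *)
have b0 : boundary K 0.
  have [_ /(_ [set 0])[_ /(_ erefl)[_ + _]] _] := hB.
  by apply.
have [_ /(_ [set 0; x])[set0x _] _] := hB.
suff /set0x S0 : [/\ [set 0; x] !=set0, [set 0; x] `<=` boundary K
    & invariant_set B [set 0; x]].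
  by have : [set 0; x] x by [right]; rewrite S0 => /eqP; apply/negP.
split; first by exists 0; left.
  by move=> _ [] ->.
by move=> _ [y _ <-]; left; rewrite B0 mul0mx.
Qed.

Let base := cone_base K.

Lemma cone_base_normalize x : K x -> x != 0 -> base (`|x|^-1 *: x).
Proof.
move=> Kx x0; split; first by apply: coneZ => //; rewrite invr_ge0.
by rewrite normrZ normfV normr_id mulVf ?normr_eq0.
Qed.

Lemma cone_nonzero : exists2 x, K x & x != 0.
Proof.
have [v Kv] := cone_interiorP hK; exists v; first exact: interior_subset.
have [i vi] := cone_interior_coord hK N_gt0 Kv.
by apply: contraNneq vi => ->; rewrite mxE.
Qed.

(** At [s = 0] the vector [x - s *: (B *m x)] is [x], which is not in [- K]; by compactness of the
    base this persists for all small [s], uniformly in [x]. A large [t] would contradict it with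
    [s = t^-1]. *)
Lemma collatz_wielandt_bounded :
  exists c : R, forall t x, base x -> K (B *m x - t *: x) -> t <= c.
Proof.
have : \forall s \near (0 : R), base `<=` [set x | ~ K (- (x - s *: (B *m x)))].
  have /compact_near_coveringP := cone_base_compact hK.
  move=> /(_ R (nbhs 0) (fun s x => ~ K (- (x - s *: (B *m x))))).
  apply=> x bx.
  apply: (@near_affine_pair _ _ id (mulmx B) [set y | ~ K (- y)]).
  - by move=> y; apply: cvg_id.
  - exact: mulmx_continuous.
  - rewrite scale0r subr0; apply: open_nbhs_nbhs; split.
      apply: closed_openC.
      apply: (@preimage_closed _ _ (fun y : 'cV[R]_N => - y) K).
        by move=> y _; apply: opp_continuous.
      exact: cone_closed.
    have [Kx x1] := bx; move=> /(cone_pointed hK Kx) x0.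
    by move/eqP: x1; rewrite x0 normr0 eq_sym oner_eq0.
move=> /nbhs_norm0P[e /= e0 He].
exists (2 / e) => t x bx Kt; rewrite leNgt; apply/negP => te.
have t0 : 0 < t by apply: lt_trans te; rewrite divr_gt0.
have /(He t^-1) := bx; rewrite /=; apply.
  rewrite gtr0_norm ?invr_gt0 // invf_plt ?posrE //.
  by apply: le_lt_trans te; rewrite ler_pdivlMr // mulVf ?gt_eqF // ler1n.
have -> : - (x - t^-1 *: (B *m x)) = t^-1 *: (B *m x - t *: x).
  by rewrite opprB scalerBr scalerA mulVf ?scale1r ?gt_eqF.
by apply: coneZ => //; rewrite invr_ge0 ltW.
Qed.

Lemma collatz_wielandt_eigenvector :
  exists r, exists v, [/\ 0 <= r, base v & B *m v = r *: v].
Proof.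
pose T := [set t | exists2 x, base x & K (B *m x - t *: x)].
have [x0 Kx0 x00] := cone_nonzero.
have bx0 := cone_base_normalize Kx0 x00.
have T0 : T 0.
  exists (`|x0|^-1 *: x0) => //; rewrite scale0r subr0; apply: primitive_stable.
  by case: bx0.
have [c Tc] := collatz_wielandt_bounded.
have sT : has_sup T.
  split; first by exists 0.
  by exists c => t [x bx Kt]; apply: Tc Kt.
pose r := sup T.
have r0 : 0 <= r by apply: ub_le_sup => //; case: sT.
(* The supremum is attained: otherwise compactness of the base would exclude a whole neighbourhood
   of [r] from [T]. *)
have [v bv Kv] : T r.
  apply: contrapT => nTr.
  have : \forall t \near r, base `<=` [set x | ~ K (B *m x - t *: x)].
    have /compact_near_coveringP := cone_base_compact hK.
    move=> /(_ R (nbhs r) (fun t x => ~ K (B *m x - t *: x))).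
    apply=> x bx.
    apply: (@near_affine_pair _ _ (mulmx B) id [set y | ~ K y]).
    - exact: mulmx_continuous.
    - by move=> y; apply: cvg_id.
    - apply: open_nbhs_nbhs; split.
        by apply: closed_openC; apply: cone_closed.
      by move=> Kx; apply: nTr; exists x.
  move=> /nbhs_normP[e /= e0 He].
  have [t [x bx Kt] rt] := sup_adherent e0 sT.
  apply: (He t _ x bx Kt); rewrite /= ltr_norml.
  have tr : t <= r by apply: ub_le_sup; [case: sT|exists x].
  rewrite -/r in rt; apply/andP; split; lra.
exists r, v; split => //; apply/eqP; rewrite -subr_eq0; apply: contraT => d0.
(* Otherwise, for some k and e > 0, y = B^k v satisfies B y - (r + e) y in K,
   against the maximality of r. *)
have [k Kk] := primitive_orbit_interior Kv d0.
pose y := B ^+ k *m v.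
have yE : B ^+ k *m (B *m v - r *: v) = B *m y - r *: y.
  rewrite mulmxBr -scalemxAr /y !mulmxA.
  by rewrite -[B ^+ k *m B]/(B ^+ k * B) -exprSr exprS.
rewrite yE in Kk.
have Ky : K y by apply: primitive_stable_exp; case: bv.
have y0 : y != 0.
  have [i yi] := cone_interior_coord hK N_gt0 Kk; move: yi.
  by apply: contraNneq => ->; rewrite mulmx0 scaler0 subr0 mxE.
have [e e0 Ke] : exists2 e : R, 0 < e & K (B *m y - (r + e) *: y).
  have Ky' : nbhs (B *m y + r *: (- y)) K by rewrite scalerN.
  have /nbhs_normP[e /= e0 He] := @affine_continuous R _ (B *m y) (- y) r _ Ky'.
  exists (e / 2); first by rewrite divr_gt0.
  rewrite -scalerN; apply: He => /=.
  rewrite opprD addNKr normrN gtr0_norm ?divr_gt0 //; lra.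
have : r + e <= r.
  apply: ub_le_sup; first by case: sT.
  exists (`|y|^-1 *: y); first exact: cone_base_normalize.
  have -> : B *m (`|y|^-1 *: y) - (r + e) *: (`|y|^-1 *: y) =
      `|y|^-1 *: (B *m y - (r + e) *: y).
    by rewrite scalerBr -scalemxAr !scalerA [_ * _^-1]mulrC.
  by apply: coneZ => //; rewrite invr_ge0.
by rewrite gerDl leNgt e0.
Qed.

Lemma primitive_interior_eigenvector : exists r, exists v,
  [/\ 0 < r, interior K v, `|v| = 1 & B *m v = r *: v].
Proof.
have [r [v [r0 [Kv v1] Bv]]] := collatz_wielandt_eigenvector.
have v0 : v != 0 by rewrite -normr_eq0 v1 oner_eq0.
have [k Kk] := primitive_orbit_interior Kv v0.
have BkE i : B ^+ i *m v = r ^+ i *: v.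
  elim: i => [|i IHi]; first by rewrite !expr0 mul1mx scale1r.
  by rewrite exprSr -mulmxA Bv -scalemxAr IHi scalerA -exprS.
rewrite BkE in Kk.
have rk0 : r ^+ k != 0.
  have [i yi] := cone_interior_coord hK N_gt0 Kk; move: yi.
  by apply: contraNneq => ->; rewrite scale0r mxE.
have Kiv : interior K v.
  rewrite -(scalerK rk0 v); apply: cone_interiorZ => //.
  by rewrite invr_gt0 lt_neqAle eq_sym rk0 exprn_ge0.
exists r, v; split=> //; rewrite lt_neqAle r0 andbT eq_sym.
(* The exponent [k] may be 0, so [r != 0] needs its own argument: if [B *m v = 0], applying [B] to
   the order unit inequality puts every [B *m x] and its opposite in [K], so [B = 0]. *)
apply: contraNneq primitive_neq0 => r00.
have [c c0 Kc] := cone_order_unit hK Kiv.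
have B0 x : B *m x = 0.
  have KB y : K (B *m y).
    have := primitive_stable (Kc y).
    by rewrite mulmxDr -scalemxAr Bv r00 scale0r scaler0 add0r.
  by apply: (cone_pointed hK) => //; rewrite -mulmxN.
apply/eqP/matrixP => i j.
by have /colP/(_ i) := B0 (basis_vec R j); rewrite -colE !mxE.
Qed.

End PrimitiveOperator.

(** * Contraction of oscillation for an operator fixing an interior vector *)

Section Normalized.
Variables (R : realType) (N : nat) (K : set 'cV[R]_N) (C : 'M[R]_N).
Variable v : 'cV[R]_N.
Hypotheses (hK : proper_cone K) (CK : forall x, K x -> K (C *m x)).
Hypothesis Cint : forall x, K x -> x != 0 -> exists k, interior K (C ^+ k *m x).
Hypotheses (Kv : interior K v) (v1 : `|v| = 1) (Cv : C *m v = v).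
Implicit Types (x y : 'cV[R]_N).

Let CkK k x : K x -> K (C ^+ k *m x).
Proof.
move=> Kx; elim: k => [|k IHk]; first by rewrite expr0 mul1mx.
by rewrite exprS -mulmxA; apply: CK.
Qed.

Let Ckv k : C ^+ k *m v = v.
Proof.
by elim: k => [|k IHk]; rewrite ?expr0 ?mul1mx // exprSr -mulmxA Cv.
Qed.

Let Kv' : K v. Proof. exact: interior_subset. Qed.

(** Each [x] of the base has an interior iterate [C ^+ k *m x], from which a small multiple of [v]
    can be subtracted, also for vectors near [x]. As [C] preserves [K] and fixes [v], this remains
    true for all later exponents, and compactness yields one exponent for the whole base. *)
Lemma uniform_positivity : exists m, exists2 e : R, 0 < e <= 1 &
  forall y, K y -> K (C ^+ m *m y - (e * `|y|) *: v).
Proof.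
have : \forall n \near \oo,
    cone_base K `<=` [set x | K (C ^+ n *m x - harmonic n *: v)].
  have /compact_near_coveringP := cone_base_compact hK.
  move=> /(_ nat \oo (fun n x => K (C ^+ n *m x - harmonic n *: v))).
  apply=> x [Kx x1].
  have [|k Kk] := Cint Kx; first by rewrite -normr_eq0 x1 oner_eq0.
  have cmul : continuous (mulmx (C ^+ k) : 'cV[R]_N -> 'cV[R]_N).
    exact: mulmx_continuous.
  have cv : continuous (cst v : 'cV[R]_N -> 'cV[R]_N) by exact: cst_continuous.
  have := @near_affine_pair _ _ _ _ K x 0 cmul cv.
  rewrite scale0r subr0 => /(_ Kk)[[U W] /= [xU W0] UW].
  (* One index [n] serves both as exponent and, through [harmonic n], as the size of the subtracted
     multiple. *)
  exists (U, [set n | (k <= n)%N /\ W (harmonic n)]) => /=.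
    split=> //; apply: filterI; first by exists k.
    exact: cvg_harmonic.
  move=> [y n] /= [Uy [kn Wn]].
  have -> : C ^+ n *m y - harmonic n *: v =
      C ^+ (n - k) *m (C ^+ k *m y - harmonic n *: v).
    rewrite mulmxBr -scalemxAr Ckv mulmxA.
    by rewrite -[C ^+ _ *m C ^+ _]/(C ^+ _ * C ^+ _) -exprD subnK.
  by apply: CkK; apply: (UW (y, harmonic n)).
move=> [m _ /(_ m (leqnn m)) Hm]; exists m, (harmonic m).
  by rewrite /harmonic /= invr_gt0 ltr0n /= invf_le1 ?ler1n ?ltr0n.
move=> y Ky; have [->|y0] := eqVneq y 0.
  by rewrite normr0 mulr0 scale0r mulmx0 subr0; apply: cone0.
have /Hm /= Kn := cone_base_normalize hK Ky y0.
have -> : C ^+ m *m y - (harmonic m * `|y|) *: v =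
    `|y| *: (C ^+ m *m (`|y|^-1 *: y) - harmonic m *: v).
  rewrite scalerBr -scalemxAr !scalerA mulfV ?normr_eq0 // scale1r.
  by rewrite [_ * `|y|]mulrC.
by apply: coneZ.
Qed.

(** In the order of [K], [x] lies between [a *: v] and [(a + s) *: v]. The least such [s] is Hopf's
    oscillation of [x] relative to [v]; the relational form avoids taking an infimum. *)
Definition osc_le x (s : R) :=
  exists a : R, K (x - a *: v) /\ K ((a + s) *: v - x).

Lemma osc_leW x s t : s <= t -> osc_le x s -> osc_le x t.
Proof.
move=> st [a [K1 K2]]; exists a; split=> //.
have -> : (a + t) *: v - x = (a + s) *: v - x + (t - s) *: v.
  by apply/colP => i; rewrite !mxE; ring.
by apply: coneD => //; apply: coneZ => //; rewrite subr_ge0.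
Qed.

Lemma osc_le_shift x (b s : R) : osc_le x s -> osc_le (x + b *: v) s.
Proof.
move=> [a [K1 K2]]; exists (a + b); split.
  by rewrite scalerDl opprD addrACA subrr addr0.
by move: K2; congr K; apply/colP => i; rewrite !mxE; ring.
Qed.

Lemma osc_le_norm : exists2 c : R, 0 < c & forall x, osc_le x (c * `|x|).
Proof.
have [c c0 Kc] := cone_order_unit hK Kv.
exists (2 * c) => [|x]; first by rewrite mulr_gt0.
exists (- (c * `|x|)); split; first by rewrite scaleNr opprK addrC.
have := Kc (- x); rewrite normrN.
by congr K; apply/colP => i; rewrite !mxE; ring.
Qed.

Section Contraction.
Variables (D : 'M[R]_N) (e : R).
Hypotheses (e01 : 0 < e <= 1) (Dv : D *m v = v).
Hypothesis De : forall y, K y -> K (D *m y - (e * `|y|) *: v).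

Lemma cone_ge_norm y (s : R) : K y -> K (s *: v - y) -> e * `|y| <= s.
Proof.
move=> Ky Ks; rewrite leNgt; apply/negP => se.
have K1 : K (s *: v - D *m y).
  have := De Ks; rewrite mulmxBr -scalemxAr Dv => K1.
  rewrite -[X in K X](subrK ((e * `|s *: v - y|) *: v)).
  apply: coneD => //; apply: coneZ => //; rewrite mulr_ge0 //.
  by case/andP: e01 => /ltW.
have K2 : K ((s - e * `|y|) *: v).
  have := coneD hK K1 (De Ky); congr K.
  by rewrite addrA subrK scalerBl.
have v0 : v = 0.
  apply: (cone_pointed hK) => //.
  have -> : - v = (e * `|y| - s)^-1 *: ((s - e * `|y|) *: v).
    rewrite scalerA -[s - _]opprB mulrN mulVf ?scaleN1r //.
    by rewrite subr_eq0 gt_eqF.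
  by apply: coneZ => //; rewrite invr_ge0 subr_ge0 ltW.
by move: v1; rewrite v0 normr0 => /eqP; rewrite eq_sym oner_eq0.
Qed.

(** The gaps [y] and [y'] of [x] to its two bounds add up to [s *: v], so their norms add up to at
    least [s]. Applying [D] moves the lower bound up by [e *]|y|[and the upper one down by]e *
    [|y'|]. *)
Lemma osc_le_contract x s : osc_le x s -> osc_le (D *m x) ((1 - e) * s).
Proof.
move=> [a [K1 K2]]; have [/De K1' /De K2'] := (K1, K2).
set y := x - a *: v in K1 K1'; set y' := (a + s) *: v - x in K2 K2'.
have s0 : 0 <= s.
  have : K (s *: v - y').
    by move: K1; congr K; apply/colP => i; rewrite !mxE; ring.
  move/(cone_ge_norm K2); apply: le_trans; rewrite mulr_ge0 //.
  by case/andP: e01 => /ltW.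
have yy' : s <= `|y| + `|y'|.
  have -> : s = `|y + y'| .
    have -> : y + y' = s *: v by apply/colP => i; rewrite !mxE; ring.
    by rewrite normrZ v1 mulr1 ger0_norm.
  exact: ler_normD.
apply: (@osc_leW _ (s - e * `|y| - e * `|y'|)).
  rewrite mulrBl mul1r -addrA -opprD lerD2l lerN2 -mulrDr ler_pM2l //.
  by case/andP: e01.
exists (a + e * `|y|); split.
  move: K1'; congr K; rewrite mulmxBr -scalemxAr Dv.
  by apply/colP => i; rewrite !mxE; ring.
move: K2'; congr K; rewrite mulmxBr -scalemxAr Dv.
by apply/colP => i; rewrite !mxE; ring.
Qed.

Lemma osc_le_all x : (forall s, 0 < s -> osc_le x s) -> exists a, x = a *: v.
Proof.
move=> xs; have e0 : 0 < e by case/andP: e01.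
have [i vi] : exists i, v i 0 != 0.
  apply/existsP; apply: contraT; rewrite negb_exists => /forallP v0.
  have := v1; suff -> : v = 0 by move/eqP; rewrite normr0 eq_sym oner_eq0.
  by apply/colP => i; apply/eqP; rewrite mxE; have := v0 i; rewrite negbK.
(* The [i]-th coordinate leaves only this candidate. The error is [x - a *: v] plus a correction at
   most [|v i 0|^-1] times as large, which explains [L]. *)
pose a0 := x i 0 / v i 0; exists a0; apply/eqP; rewrite -subr_eq0 -normr_le0.
pose L := 1 + `|v i 0|^-1; have L0 : 0 < L by rewrite ltr_pwDl.
apply/ler_addgt0Pl => d d0; rewrite addr0.
have dL : 0 < e * (d / L) by rewrite mulr_gt0 // divr_gt0.
have [a [K1 K2]] := xs _ dL.
have K3 : K ((e * (d / L)) *: v - (x - a *: v)).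
  by move: K2; congr K; apply/colP => j; rewrite !mxE; ring.
have := cone_ge_norm K1 K3; rewrite ler_pM2l // => xa.
have -> : x - a0 *: v = (x - a *: v) - (a0 - a) *: v.
  by apply/colP => j; rewrite !mxE; ring.
apply: le_trans (ler_normB _ _) _; rewrite normrZ v1 mulr1.
have aa : `|a0 - a| <= `|v i 0|^-1 * (d / L).
  have -> : a0 - a = (v i 0)^-1 * (x - a *: v) i 0.
    by rewrite !mxE mulrBr [a * _]mulrC mulKf // mulrC.
  rewrite normrM normfV ler_wpM2l ?invr_ge0 //.
  by apply: le_trans xa; apply: mx_entry_le_norm.
apply: le_trans (lerD xa aa) _.
by rewrite -[X in X + _]mul1r -mulrDl -/L mulrC divfK ?gt_eqF.
Qed.

Lemma osc_le_geometric x s : (forall k, osc_le x ((1 - e) ^+ k * s)) ->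
  exists a, x = a *: v.
Proof.
move=> xk; apply: osc_le_all => t t0.
have /andP[e0 e1] := e01.
have : (fun k => (1 - e) ^+ k * s) @ \oo --> 0 * s.
  apply: cvgMl; apply: cvg_expr; rewrite ger0_norm ?subr_ge0 //.
  by rewrite ltrBlDr ltrDl.
rewrite mul0r => /cvgr_lt /(_ _ t0)[k _ /(_ k (leqnn k)) /= kt].
exact: osc_leW (ltW kt) (xk k).
Qed.

End Contraction.
End Normalized.

(** * Complex vectors and the spectral gap *)

Lemma ReD (R : rcfType) (x y : R[i]) :
  complex.Re (x + y) = complex.Re x + complex.Re y.
Proof. by case: x y => [a b] [c d]. Qed.

Lemma Re_real_mul (R : rcfType) (a : R) (z : R[i]) :
  complex.Re (real_complex R a * z) = a * complex.Re z.
Proof. by case: z => b c; rewrite /GRing.mul /= mul0r subr0. Qed.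

Lemma norm_imaginary_unit (R : rcfType) : `|'i%C : R[i]| = 1.
Proof. by rewrite normc_def /= expr0n expr1n add0r sqrtr1. Qed.

Lemma map_Re_mulmx (R : realType) (N : nat) (D : 'M[R]_N) (w : 'cV[R[i]]_N) :
  map_mx (@complex.Re R) (complexify D *m w) = D *m map_mx (@complex.Re R) w.
Proof.
apply/colP => i; rewrite !mxE.
rewrite (big_morph _ (@ReD R) (erefl : complex.Re 0 = 0)).
by apply: eq_bigr => k _; rewrite !mxE Re_real_mul.
Qed.

Definition real_col (R : realType) (N : nat) (v : 'cV[R]_N) : 'cV[R[i]]_N :=
  map_mx (real_complex R) v.

Lemma map_Re_scale_real (R : realType) (N : nat) (a : R[i]) (v : 'cV[R]_N) :
  map_mx (@complex.Re R) (a *: real_col v) = complex.Re a *: v.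
Proof. by apply/colP => i; rewrite !mxE mulrC Re_real_mul mulrC. Qed.

Lemma map_Re_scale (R : realType) (N : nat) (u : R[i]) (w : 'cV[R[i]]_N) :
  map_mx (@complex.Re R) (u *: w) =
  complex.Re u *: map_mx (@complex.Re R) w -
  complex.Im u *: map_mx (@complex.Im R) w.
Proof. by apply/colP => i; rewrite !mxE; case: u (w i 0) => [a b] [c d]. Qed.

Lemma map_Re_add (R : realType) (N : nat) (x y : 'cV[R[i]]_N) :
  map_mx (@complex.Re R) (x + y) =
  map_mx (@complex.Re R) x + map_mx (@complex.Re R) y.
Proof. by apply/colP => i; rewrite !mxE ReD. Qed.

Lemma complexify_exp (R : realType) (N : nat) (C : 'M[R]_N) k :
  complexify (C ^+ k) = complexify C ^+ k.
Proof. exact: rmorphXn. Qed.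

Lemma complex_col_real_span (R : realType) (N : nat) (v : 'cV[R]_N)
    (w : 'cV[R[i]]_N) (a b : R) :
  map_mx (@complex.Re R) w = a *: v -> map_mx (@complex.Im R) w = b *: v ->
  w = Complex a b *: real_col v.
Proof.
move=> /colP wa /colP wb; apply/colP => i; have := wa i; have := wb i.
rewrite !mxE; case: (w i 0) => c d /= -> ->.
by apply/eqP; rewrite eq_complex /= !mulr0 subr0 add0r !eqxx.
Qed.

Section SpectralGap.
Variables (R : realType) (N : nat) (K : set 'cV[R]_N) (v : 'cV[R]_N).
Hypotheses (hK : proper_cone K) (Kv : interior K v) (v1 : `|v| = 1).

Lemma modulus_ge1_span (D : 'M[R]_N) (e : R) (w : 'cV[R[i]]_N) (z a : R[i]) :
  0 < e <= 1 -> D *m v = v ->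
  (forall y, K y -> K (D *m y - (e * `|y|) *: v)) ->
  complexify D *m w = z *: w + a *: real_col v -> 1 <= `|z| ->
  exists b, w = b *: real_col v.
Proof.
move=> e01 Dv De Dw z1.
have z0 : z != 0 by rewrite -normr_eq0 gt_eqF // (lt_le_trans ltr01).
have [c c0 vc] := osc_le_norm hK Kv.
set Rw := map_mx (@complex.Re R) w; set Iw := map_mx (@complex.Im R) w.
pose s := c * (`|Rw| + `|Iw|).
(* Up to multiples of v, u w is the image under D of (u / z) w, and u / z lies
   in the unit disc again. *)
have osc k (u : R[i]) : `|u| <= 1 ->
    osc_le K v (map_mx (@complex.Re R) (u *: w)) ((1 - e) ^+ k * s).
  elim: k u => [|k IHk] u u1.
    rewrite expr0 mul1r; apply: (osc_leW hK Kv _ (vc _)).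
    rewrite ler_pM2l // map_Re_scale; apply: le_trans (ler_normB _ _) _.
    have [Ru Iu] : `|complex.Re u| <= 1 /\ `|complex.Im u| <= 1.
      split; rewrite -lecR; apply: le_trans u1; first exact: normc_ge_Re.
      have := normc_ge_Re (u * 'i%C); rewrite ReiNIm normrN normrM.
      by rewrite norm_imaginary_unit mulr1.
    by rewrite !normrZ lerD // ler_piMl.
  have -> : map_mx (@complex.Re R) (u *: w) =
      D *m map_mx (@complex.Re R) ((u / z) *: w) +
      complex.Re (- (u / z * a)) *: v.
    rewrite -map_Re_mulmx -map_Re_scale_real -map_Re_add; congr map_mx.
    rewrite -scalemxAr Dw scalerDr !scalerA divfK //.
    by rewrite scaleNr addrK.
  apply: osc_le_shift; rewrite exprS -mulrA.
  apply: (osc_le_contract hK Kv v1) => //.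
  apply: IHk; rewrite normrM normfV ler_pdivrMr ?mul1r ?normr_gt0 //.
  exact: le_trans z1.
(* The multiplier [u = 1] yields the real part of [w], and [u = - 'i] below its imaginary part. *)
have [b1 Eb1] : exists b, Rw = b *: v.
  apply: (osc_le_geometric hK Kv v1 e01 Dv De (s := s)) => k.
  by have := osc k 1; rewrite scale1r normr1; apply.
have [b2 Eb2] : exists b, Iw = b *: v.
  apply: (osc_le_geometric hK Kv v1 e01 Dv De (s := s)) => k.
  have := osc k (- 'i%C); rewrite normrN norm_imaginary_unit lexx => /(_ isT).
  rewrite map_Re_scale /= oppr0 scale0r sub0r.
  by rewrite -scaleNr opprK scale1r.
by exists (Complex b1 b2); apply: complex_col_real_span.
Qed.

End SpectralGap.

(** A root [z] of the deflated polynomial with modulus at least [r] would give a vector [w] outside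
    the span of [v] with [B w = z w + a v]; the contraction by a power of [B / r] excludes it. In
    particular [r] is a simple root. *)
Theorem primitive_char_poly (R : realType) (N : nat) (K : set 'cV[R]_N)
    (B : 'M[R]_N) :
  (0 < N)%N -> proper_cone K -> cone_primitive K B ->
  exists2 r : R, 0 < r & exists2 q : {poly R[i]},
    char_poly (complexify B) = ('X - (real_complex R r)%:P) * q &
    forall z, root q z -> `|z| < real_complex R r.
Proof.
move=> N0 hK hB.
have [r [v [r0 Kv v1 Bv]]] := primitive_interior_eigenvector hK hB N0.
exists r => //.
have rn0 : r != 0 by rewrite gt_eqF.
pose C := r^-1 *: B.
have Cv : C *m v = v by rewrite -scalemxAl Bv scalerK.
have CK x : K x -> K (C *m x).
  move=> Kx; rewrite -scalemxAl; apply: coneZ => //.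
    by rewrite invr_ge0 ltW.
  exact: (primitive_stable hB).
have CkE k : C ^+ k = r^-1 ^+ k *: B ^+ k.
  elim: k => [|k IHk]; first by rewrite !expr0 scale1r.
  have mulE (X Y : 'M[R]_N) : X * Y = X *m Y by [].
  by rewrite !exprS IHk !mulE -scalemxAl -scalemxAr scalerA.
have Cint x : K x -> x != 0 -> exists k, interior K (C ^+ k *m x).
  move=> Kx x0; have [k Kk] := primitive_orbit_interior hB Kx x0; exists k.
  rewrite CkE -scalemxAl; apply: cone_interiorZ => //.
  by rewrite exprn_gt0 ?invr_gt0.
have [m [e e01 He]] := uniform_positivity hK CK Cint Cv.
have [||q Bq qz] := @char_poly_deflate _ _ (complexify B) (real_col v)
  (real_complex R r).
- by rewrite map_mx_eq0 -normr_eq0 v1 oner_eq0.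
- by rewrite /complexify /real_col -map_mxM Bv map_mxZ.
exists q => // z /qz[w [a [Bw wv]]].
have rC0 : 0 < real_complex R r by rewrite ltcR.
rewrite real_ltNge ?normr_real ?gtr0_real //; apply/negP => rz.
have Cw : complexify C *m w = (z / real_complex R r) *: w
    + (a / real_complex R r) *: real_col v.
  rewrite /complexify map_mxZ -scalemxAl Bw scalerDr !scalerA fmorphV.
  by rewrite ![_^-1 * _]mulrC.
set z' := z / _ in Cw; set a' := a / _ in Cw.
(* Since [C] fixes [v], iterating only changes the multiple of [v]. *)
have [k Ckw] : exists b,
    complexify (C ^+ m) *m w = z' ^+ m *: w + b *: real_col v.
  elim: (m) => [|k [b IHk]].
    by exists 0; rewrite complexify_exp !expr0 mul1mx scale1r scale0r addr0.
  exists (b + z' ^+ k * a'); rewrite complexify_exp exprS -mulmxA.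
  rewrite -complexify_exp IHk mulmxDr -!scalemxAr Cw.
  have -> : complexify C *m real_col v = real_col v.
    by rewrite /complexify /real_col -map_mxM Cv.
  by rewrite scalerDr !scalerA -exprSr -addrA -scalerDl [_ + b]addrC.
have Cmv : C ^+ m *m v = v.
  by elim: (m) => [|k' IH]; rewrite ?expr0 ?mul1mx // exprSr -mulmxA Cv.
have [|b wb] := modulus_ge1_span hK Kv v1 e01 Cmv He Ckw.
  rewrite normrX exprn_ege1 // normrM normfV.
  by rewrite (gtr0_norm rC0) ler_pdivlMr // mul1r.
by have /eqP := wv b.
Qed.

Local Close Scope classical_set_scope.

(** * Eigenvalues ordered by modulus *)

(** Cancelling one factor equal to ['X - r%:P] leaves [q] as the product of the others. Separating
    by index rather than by value takes care of multiplicities. *)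
Lemma prod_XsubC_cofactor (F : fieldType) (I : finType) (mu : I -> F) (r : F)
    (q : {poly F}) :
  \prod_i ('X - (mu i)%:P) = ('X - r%:P) * q ->
  exists2 i0, mu i0 = r & forall i, i != i0 -> root q (mu i).
Proof.
move=> mq; have /rootP : root (\prod_i ('X - (mu i)%:P)) r.
  by rewrite mq rootM root_XsubC eqxx.
rewrite horner_prod => /eqP/prodf_eq0[i0 _].
rewrite !hornerE subr_eq0 => /eqP Er; exists i0 => // i ii0.
have <- : \prod_(i | i != i0) ('X - (mu i)%:P) = q.
  apply: (mulfI (negbT (polyXsubC_eq0 r))).
  by rewrite -mq [RHS](bigD1 i0) //= -Er.
by rewrite (bigD1 i) //= rootM root_XsubC eqxx.
Qed.

Lemma incr_of_set (n j : nat) (S : {set 'I_n}) :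
  #|S| = j -> exists l : 'I_('C(n, j)), incr l =i S.
Proof.
move=> <-.
pose t : #|S|.-tuple 'I_n := [tuple of enum S].
have tS : t \in incr_tuples n #|S|.
  rewrite inE sorted_map /enum_mem; apply: sorted_filter.
    by move=> ? ? ?; apply: ltn_trans.
  by rewrite -sorted_map -enumT val_enum_ord iota_ltn_sorted.
exists (cast_ord (esym (card_incr_tuples n #|S|)) (enum_rank_in tS t)) => i.
by rewrite /incr cast_ordKV enum_rankK_in // mem_enum.
Qed.

Section OrderedEigenvalues.
Variables (R : realType) (n : nat) (A : 'M[R]_n).
Variable lam : 'I_n -> R[i].
Hypotheses (hA : generalized_even_oscillatory A)
  (Alam : char_poly (complexify A) = \prod_(i < n) ('X - (lam i)%:P))
  (lam_le : forall i j : 'I_n, (i <= j)%N -> `|lam j| <= `|lam i|).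

(** Index sets of size [j] label the roots of the characteristic polynomial of the exterior power;
    [S0] labels its Perron root, and every other set a root of the cofactor. *)
Lemma even_dominant_set (j : nat) : (1 <= j <= n)%N -> ~~ odd j ->
  exists S0 : {set 'I_n}, [/\ #|S0| = j, 0 < \prod_(i in S0) lam i &
    forall S : {set 'I_n}, #|S| = j -> S != S0 ->
      `|\prod_(i in S) lam i| < \prod_(i in S0) lam i].
Proof.
move=> jn ej; have [K [hK prim]] := hA jn ej.
have N0 : (0 < 'C(n, j))%N by rewrite bin_gt0; case/andP: jn.
have [r r0 [q]] := primitive_char_poly N0 hK prim.
rewrite (char_poly_ext_power _ Alam) => /prod_XsubC_cofactor[l0 El0 ql] qr.
have prodE l : \prod_(i <- incr l) lam i =
    \prod_(i in [set i in (incr l : j.-tuple 'I_n)]) lam i.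
  by rewrite big_uniq ?incr_uniq //; apply: eq_bigl => i; rewrite inE.
exists [set i in incr l0]; rewrite -prodE El0; split.
- by rewrite cardsE (card_uniqP (incr_uniq l0)) size_tuple.
- by rewrite ltcR.
move=> S Sj S0; have [l lS] := incr_of_set Sj.
have ES : S = [set i in incr l] by apply/setP => i; rewrite inE lS.
have {ES} -> : \prod_(i in S) lam i = \prod_(i <- incr l) lam i.
  by rewrite prodE -ES.
apply/qr/ql; apply: contra S0 => /eqP <-.
by apply/eqP/setP => i; rewrite inE lS.
Qed.

Definition initial_seg (j : nat) : {set 'I_n} := [set i : 'I_n | (i < j)%N].

Lemma card_initial_seg j : (j <= n)%N -> #|initial_seg j| = j.
Proof.
move=> jn; rewrite -sum1_card (eq_bigl (fun i : 'I_n => (i < j)%N)) => [|i].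
  by rewrite (big_ord_narrow jn) sum1_card card_ord.
by rewrite inE.
Qed.

(** If the dominant set were another one, exchanging one of its indices [b >= j] for a missing
    [a < j] would not decrease the modulus of the product, against strict dominance. *)
Lemma even_dominant_initial (j : nat) : (1 <= j <= n)%N -> ~~ odd j ->
  0 < \prod_(i in initial_seg j) lam i /\
  forall S : {set 'I_n}, #|S| = j -> S != initial_seg j ->
    `|\prod_(i in S) lam i| < \prod_(i in initial_seg j) lam i.
Proof.
move=> jn ej; have [S0 [cS0 S0pos S0dom]] := even_dominant_set jn ej.
have cI := card_initial_seg (proj2 (andP jn)).
have [<-//|IS0] := eqVneq S0 (initial_seg j).
have [a aI aS0] : exists2 a, a \in initial_seg j & a \notin S0.
  apply/subsetPn; apply: contra IS0 => sIS; rewrite eq_sym eqEcard sIS.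
  by rewrite cI cS0 leqnn.
have [b bS0 bI] : exists2 b, b \in S0 & b \notin initial_seg j.
  apply/subsetPn; apply: contra IS0 => sIS; rewrite eqEcard sIS.
  by rewrite cI cS0 leqnn.
have aS0' : a \notin S0 :\ b by rewrite !inE negb_and aS0 orbT.
have cS : #|a |: (S0 :\ b)| = j.
  by rewrite cardsU1 aS0' -cS0 (cardsD1 b S0) bS0.
have /(S0dom _ cS) : a |: (S0 :\ b) != S0.
  by apply: contraNneq aS0 => <-; rewrite !inE eqxx.
rewrite big_setU1 //= normrM real_ltNge ?realM ?normr_real ?gtr0_real //.
rewrite -(gtr0_norm S0pos) (big_setD1 b bS0) /= normrM ler_wpM2r ?normr_ge0 //.
apply: lam_le; move: aI bI; rewrite !inE -leqNgt => aj jb.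
exact: leq_trans (ltnW aj) jb.
Qed.

(** With indices from 0, an odd [i] ends an initial segment of even size [i.+1]. Replacing [i] by
    [k] in it strictly decreases the modulus, and the common factor is nonzero. *)
Lemma lam_lt (i k : 'I_n) : odd i -> val k = i.+1 -> `|lam k| < `|lam i|.
Proof.
move=> oi ki; have jn : (1 <= i.+1 <= n)%N by rewrite ltn_ord.
have ej : ~~ odd i.+1 by rewrite /= oi.
have [Ipos] := even_dominant_initial jn ej.
set I := initial_seg i.+1 in Ipos *.
have iI : i \in I by rewrite inE /=.
have kI : k \notin I by rewrite inE ki ltnn.
have kI' : k \notin I :\ i by rewrite in_setD1 (negbTE kI) andbF.
have cS : #|k |: (I :\ i)| = i.+1.
  rewrite cardsU1 kI' -[RHS](card_initial_seg (ltn_ord i)) -/I.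
  by rewrite [RHS](cardsD1 i) iI.
move=> /(_ _ cS).
have -> : k |: (I :\ i) != I by apply: contraNneq kI => <-; rewrite !inE eqxx.
move=> /(_ isT); rewrite -(gtr0_norm Ipos) (big_setD1 i iI) big_setU1 //=.
rewrite !normrM ltr_pM2r // normr_gt0.
by apply: contraTneq Ipos => P0; rewrite (big_setD1 i iI) /= P0 mulr0 ltxx.
Qed.

(** The quotient of the positive products over the initial segments of sizes [i.+2] and [i]; for
    [i = 0] the latter is the empty product 1. *)
Lemma pair_prod_gt0 (i k : 'I_n) : ~~ odd i -> val k = i.+1 ->
  0 < lam i * lam k.
Proof.
move=> ei ki.
have pos j : (j <= n)%N -> ~~ odd j -> 0 < \prod_(i in initial_seg j) lam i.
  case: j => [_ _|j jn ej]; last by case: (@even_dominant_initial j.+1 jn ej).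
  by rewrite big_pred0 ?ltr01 // => ?; rewrite inE.
have kn : (i.+2 <= n)%N by rewrite -ki; apply: ltn_ord.
have ei2 : ~~ odd i.+2 by rewrite /= negbK.
have iI : i \in initial_seg i.+2 by rewrite inE /=.
have kI : k \in initial_seg i.+2 :\ i.
  by rewrite !inE -val_eqE /= ki; lia.
have := pos _ kn ei2; rewrite (big_setD1 i iI) (big_setD1 k kI) /= mulrA.
rewrite (_ : _ :\ k = initial_seg i); last first.
  apply/setP => m; rewrite !inE -!val_eqE /= ki.
  by case: ltngtP => //=; lia.
by rewrite pmulr_lgt0 // pos // ltnW.
Qed.

(** The product of all eigenvalues is real, being up to sign the value at 0 of a real polynomial,
    and the product of the first [n.-1] is positive because [n.-1] is even. *)
Lemma last_real (i : 'I_n) : odd n -> i.+1 = n -> complex.Im (lam i) = 0.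
Proof.
move=> on ni.
have Iprod : complex.Im (\prod_k lam k) = 0.
  have := congr1 (fun p => p.[0]) Alam; rewrite /complexify -map_char_poly.
  rewrite -{1}(rmorph0 (real_complex R)) horner_map horner_prod.
  under eq_bigr do rewrite !hornerE.
  rewrite prodrN /= card_ord -signr_odd on expr1 mulN1r.
  move/(congr1 (@complex.Im R)); case: (\prod_k _) => a b /= /eqP.
  by rewrite eq_sym oppr_eq0 => /eqP.
pose I := initial_seg n.-1.
have Ipos : 0 < \prod_(k in I) lam k.
  have [n1|n1] := posnP n.-1.
    by rewrite big_pred0 ?ltr01 // => k; rewrite inE n1.
  have jn : (1 <= n.-1 <= n)%N by rewrite n1 leq_pred.
  by case: (even_dominant_initial jn _) => //; move: on; lia.
have Eprod : \prod_k lam k = lam i * \prod_(k in I) lam k.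
  rewrite (bigD1 i) //=; congr (_ * _); apply: eq_bigl => k.
  rewrite inE -val_eqE /=; have := ltn_ord k; lia.
move: Iprod; rewrite Eprod; case: (\prod_(k in I) _) Ipos => a b.
rewrite ltcE /= => /andP[/eqP -> a0]; case: (lam i) => c d.
rewrite /GRing.mul /= mulr0 add0r => /eqP; rewrite mulf_eq0 (gt_eqF a0) orbF.
by move/eqP.
Qed.

(** Between two different pairs lies a strict drop in modulus, from the last index [m] of the pair
    of [i] to the next index [m']. Equal eigenvalues therefore share a pair, which bounds
    multiplicities by 2. *)
Lemma half_eq (i k : 'I_n) : lam i = lam k -> i./2 = k./2.
Proof.
wlog : i k / (i <= k)%N.
  by move=> wl; have [ik|/ltnW ki] := leqP i k; [exact: wl|move/esym/wl => ->].
move=> ik eik; apply: contraTeq (lexx `|lam i|) => hik.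
have mn : ((i./2).*2.+1.+1 < n)%N.
  by have := ltn_ord k; lia.
pose m := Ordinal (ltnW mn); pose m' := Ordinal mn.
rewrite -real_ltNge ?normr_real // {1}eik.
have km : `|lam k| <= `|lam m'| by apply: lam_le => /=; lia.
have mi : `|lam m| <= `|lam i| by apply: lam_le => /=; lia.
apply: le_lt_trans km (lt_le_trans _ mi).
by apply: lam_lt => //=; rewrite odd_double.
Qed.

End OrderedEigenvalues.

(** * Arguments, spectral radius and conclusion *)

Lemma arg_of_prod_gt0 (R : realType) (z w : R[i]) : 0 < z * w ->
  [/\ z != 0, w != 0 &
      exists k : int, arg w = - arg z + k%:~R * (2 * pi)].
Proof.
move=> zw; have [z0 w0] : z != 0 /\ w != 0.
  by apply/andP; rewrite -negb_or -mulf_eq0 gt_eqF.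
split=> //.
(* [w] is the conjugate of [z] times [t = z w / |z|^2], so both have the same cosine and imaginary
   parts of opposite sign. *)
have [t t0 Ew] : exists2 t : R, 0 < t & w = real_complex R t * z^*%C.
  have zz : 0 < `|z| ^+ 2 by rewrite exprn_gt0 ?normr_gt0.
  have : 0 < z * w / `|z| ^+ 2 by rewrite divr_gt0.
  case E : (z * w / `|z| ^+ 2) => [t b]; rewrite ltcE /= => /andP[/eqP b0 t0].
  exists t => //; rewrite -[real_complex R t]/(Complex t 0) -b0 -E.
  rewrite sqr_normc invfM; have zc : z^*%C != 0 by rewrite conjc_eq0.
  by field; rewrite zc z0.
have tC : 0 < real_complex R t by rewrite ltcR.
have nw : complex.Re `|w| = t * complex.Re `|z|.
  by rewrite Ew normrM (gtr0_norm tC) normcJ Re_real_mul.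
case: z w z0 w0 zw Ew nw => [a b] [c d] z0 w0 zw.
rewrite {1}/GRing.mul /= !mul0r subr0 addr0 => -[-> ->] nw; rewrite /arg /= nw.
rewrite -mulf_div divff ?gt_eqF // mul1r.
set T := acos _.
have [b0|b0|b0] := ltgtP 0 b.
- exists 0; rewrite mul0r addr0 ifF //.
  by apply/negbTE; rewrite -ltNge mulrN oppr_lt0 mulr_gt0.
- exists 0; rewrite mul0r addr0 opprK ifT //.
  by rewrite mulrN oppr_ge0 pmulr_rle0 // ltW.
have [T0|Tpi] : T = 0 \/ T = pi.
  have a0 : a != 0.
    by apply: contraNneq z0 => a0; rewrite eq_complex /= a0 -b0 !eqxx.
  rewrite /T -b0 expr0n addr0 sqrtr_sqr.
  have [ap|an] := ltP 0 a; first by left; rewrite gtr0_norm // divff // acos1.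
  right; rewrite ler0_norm // invrN mulrN divff // acosN1 //.
- by exists 0; rewrite -b0 oppr0 mulr0 lexx T0 oppr0 mul0r addr0.
(* On the negative real axis both principal arguments are [pi], whence one full turn. *)
- exists 1; rewrite -b0 oppr0 mulr0 lexx Tpi mul1r; ring.
Qed.

Lemma spectral_radius_max (R : realType) (n : nat) (A : 'M[R]_n) (z : R[i]) :
  eigenvalue (complexify A) z ->
  (forall y, eigenvalue (complexify A) y -> `|y| <= `|z|) ->
  real_complex R (spectral_radius A) = `|z|.
Proof.
move=> Az Amax; have nE (y : R[i]) : real_complex R (complex.Re `|y|) = `|y|.
  by rewrite RRe_real // normr_real.
rewrite -(nE z); congr (real_complex R _); apply/eqP; rewrite eq_le.
have ubz : ubound
    [set complex.Re `|y| | y in [set y | eigenvalue (complexify A) y]]%classic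
    (complex.Re `|z|).
  by move=> _ [y /= Ay <-]; rewrite -lecR !nE; apply: Amax.
apply/andP; split; first by apply: ge_sup => //; exists (complex.Re `|z|), z.
by apply: ub_le_sup; [exists (complex.Re `|z|)|exists z].
Qed.

(** Supplies an ordered numbering for the multiplicity bound, whose statement mentions none. *)
Lemma ordered_eigenvalues (R : realType) (n : nat) (A : 'M[R[i]]_n) :
  exists2 lam : 'I_n -> R[i],
    char_poly A = \prod_(i < n) ('X - (lam i)%:P) &
    forall i j : 'I_n, (i <= j)%N -> `|lam j| <= `|lam i|.
Proof.
have [s] := closed_field_poly_normal (char_poly A).
rewrite (monicP (char_poly_monic A)) scale1r => As.
pose leT (x y : R[i]) := complex.Re `|y| <= complex.Re `|x|.
have tot : total leT by move=> x y; apply: le_total.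
pose t := sort leT s.
have At : char_poly A = \prod_(z <- t) ('X - z%:P).
  by rewrite As; apply: perm_big; rewrite perm_sym perm_sort.
have st : size t = n.
  by apply: succn_inj; rewrite -(size_char_poly A) At size_prod_XsubC.
exists (fun i : 'I_n => t`_i).
  by rewrite At (big_nth 0) st big_mkord.
move=> i j ij.
have nE (y : R[i]) : real_complex R (complex.Re `|y|) = `|y|.
  by rewrite RRe_real // normr_real.
rewrite -(nE t`_j) -(nE t`_i) lecR.
apply: (sorted_leq_nth _ _ _ (sort_sorted tot s)) => //.
- by move=> y x z xy yz; apply: le_trans yz xy.
- by move=> x; rewrite /leT.
- by rewrite inE -/t st.
- by rewrite inE -/t st.
Qed.

(* lam i is the eigenvalue number i + 1 of A: indices start at 0. *)
Theorem theorem4 (R : realType) (n : nat) (A : 'M[R]_n)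
    (hA : generalized_even_oscillatory A) :
  (forall z : R[i], eigenvalue (complexify A) z ->
     (mup z (char_poly (complexify A)) <= 2)%N)
  /\
  (forall lam : 'I_n -> R[i],
     char_poly (complexify A) = \prod_(i < n) ('X - (lam i)%:P) ->
     (forall i j : 'I_n, (i <= j)%N -> `|lam j| <= `|lam i|) ->
     [/\ (forall i : 'I_n, val i = 0%N ->
            (real_complex R) (spectral_radius A) = `|lam i|),
         (forall i j : 'I_n, val j = i.+1 ->
            if odd i then `|lam j| < `|lam i| else `|lam j| <= `|lam i|),
         (forall i j : 'I_n, ~~ odd i -> val j = i.+1 ->
            [/\ lam i != 0, lam j != 0 &
                exists k : int, arg (lam j) = - arg (lam i) + k%:~R * (2 * pi)])
       & (odd n -> forall i : 'I_n, i.+1 = n -> complex.Im (lam i) = 0)]).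
Proof.
split.
  move=> z Az; have [lam Alam lam_le] := ordered_eigenvalues (complexify A).
  have -> : char_poly (complexify A) =
      \prod_(x <- [seq lam i | i <- enum 'I_n]) ('X - x%:P).
    by rewrite big_map Alam big_enum.
  rewrite mu_prod_XsubC -size_filter filter_map size_map.
  set s := seq.filter _ _; case Es : s => [//|i0 s'].
  have lamz i : i \in s -> lam i = z by rewrite mem_filter => /andP[/eqP].
  have si0 : i0 \in s by rewrite Es mem_head.
  rewrite -Es -(size_map val).
  (* The multiplicity counts the indices carrying [z]; all of them lie in the pair of [i0]. *)
  apply: (@uniq_leq_size _ _ [:: (i0./2).*2; (i0./2).*2.+1]).
    rewrite map_inj_uniq; last exact: val_inj.
    by rewrite filter_uniq ?enum_uniq.
  move=> _ /mapP[i si ->].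
  have /= hi := half_eq hA Alam lam_le (etrans (lamz _ si) (esym (lamz _ si0))).
  by rewrite !inE -hi /=; lia.
move=> lam Alam lam_le.
have eigE z : eigenvalue (complexify A) z -> exists i, z = lam i.
  rewrite eigenvalue_root_char Alam => /rootP; rewrite horner_prod.
  by move=> /eqP/prodf_eq0[i _]; rewrite !hornerE subr_eq0 => /eqP; exists i.
split.
- move=> i i0; apply: spectral_radius_max.
    rewrite eigenvalue_root_char Alam (bigD1 i) //= rootM root_XsubC eqxx //.
  by move=> _ /eigE[k ->]; apply: lam_le; rewrite i0.
- move=> i j ji; case: ifP => oi; first exact: (lam_lt hA Alam lam_le).
  by apply: lam_le; rewrite ji.
- move=> i j ei ji; apply: arg_of_prod_gt0.
  exact: (pair_prod_gt0 hA Alam lam_le).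
- by move=> on i ni; apply: (last_real hA Alam lam_le).
Qed.
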